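(* Let $\mathbf D=\mathbf D(k,\pi_\bullet)$ be a generalized divided power algebra over a noetherian commutative ring $k$. The following are equivalent: (a) every finitely presented $\mathbf D$-module (graded or ungraded) is torsion-free; (b) every maximal ideal of $k$ contains $\pi_n$ for infinitely many $n$.
   Context: $\pi$-sequences. A $\pi$-sequence in $k$ is a sequence $(\pi_n)_{n\ge2}$ in $k$, with $\pi_1=0$. For integers $j\ge1$ and $n,m\ge0$ put $\epsilon_j(n,m)=\lfloor (n+m)/j\rfloor-\lfloor n/j\rfloor-\lfloor m/j\rfloor$, and $C(n,m)=\prod_{j\ge2}\pi_j^{\epsilon_j(n-m,m)}$. The sequence is admissible if, whenever $(\pi_n,\pi_m)\ne k$, $n\mid m$ or $m\mid n$. GDPAs. $\mathbf D(k,\pi_\bullet)$ is the graded $k$-algebra free on basis $x^{[i]}$ ($\deg x^{[i]}=i$) with $x^{[n-m]}x^{[m]}=C(n,m)x^{[n]}$. A GDPA is such an algebra with $\pi_\bullet$ admissible. Torsion. An element $m$ of a $\mathbf D$-module $M$ is torsion if $x^{[n]}m=0$ for all sufficiently large $n$. The module $M$ is torsion-free if its only torsion element is $0$, and torsion if all its elements are torsion. *)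

(* Defs.v *)
From HB Require Import structures.
From mathcomp Require Import all_boot all_order all_algebra.
Set Implicit Arguments. Unset Strict Implicit. Unset Printing Implicit Defensive.
Import Order.TTheory GRing.Theory Num.Theory.
Local Open Scope ring_scope.

Section GDPA.
Variable k : comPzRingType.

Definition is_ideal (I : k -> Prop) : Prop :=
  [/\ I 0, (forall x y, I x -> I y -> I (x + y)) & (forall a x, I x -> I (a * x))].

Definition noetherian : Prop :=
  forall I : k -> Prop, is_ideal I ->
    exists n (g : 'I_n -> k), (forall i, I (g i)) /\
      forall x, I x -> exists c : 'I_n -> k, x = \sum_(i < n) c i * g i.

Definition maximal_ideal (M : k -> Prop) : Prop :=
  [/\ is_ideal M, ~ M 1 &
      forall J : k -> Prop, is_ideal J -> (forall x, M x -> J x) ->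
        J 1 \/ (forall x, J x -> M x)].

(* A pi-sequence is given by pi : nat -> k; only the values pi n for n >= 2
   are meaningful (pi_1 = 0 by convention, pi_0 unused). *)
Variable pi : nat -> k.

Definition eps (j n m : nat) : nat := ((n + m) %/ j - n %/ j - m %/ j)%N.

(* Cab a b = prod_{j >= 2} pi_j ^ eps_j(a, b); factors with j > a + b have
   exponent 0, so the product is finite. *)
Definition Cab (a b : nat) : k :=
  \prod_(2 <= j < (a + b).+1) pi j ^+ eps j a b.

Definition Cnm (n m : nat) : k := Cab (n - m) m.

Definition admissible : Prop :=
  forall n m : nat, (2 <= n)%N -> (2 <= m)%N ->
    ~ (exists a b : k, a * pi n + b * pi m = 1) ->
    (n %| m)%N \/ (m %| n)%N.

(* An element of D is represented by its coefficient sequence s : seq k,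
   meaning sum_i s`_i x^[i] (trailing entries beyond size s are 0). *)
(* Multiplication, from x^[a] x^[b] = C(a+b, b) x^[a+b]. *)
Definition Dmul (h p : seq k) : seq k :=
  mkseq (fun n => \sum_(a < n.+1) h`_a * p`_(n - a) * Cnm n (n - a))
        (size h + size p).

(* Since D is free over k with basis (x^[i])_i, a D-module is a k-module M
   together with the (k-linear) actions act i of the basis elements x^[i],
   satisfying the multiplication rule of D and unitality (x^[0] = 1). *)
Definition Dmodule (M : lmodType k) (act : nat -> M -> M) : Prop :=
  [/\ (forall i (a : k) (x y : M), act i (a *: x + y) = a *: act i x + act i y),
      (forall x, act 0%N x = x) &
      (forall i j x, act i (act j x) = Cnm (i + j) j *: act (i + j)%N x)].

Definition Dact (M : lmodType k) (act : nat -> M -> M) (d : seq k) (x : M) : M :=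
  \sum_(i < size d) d`_i *: act i x.

Definition Dev (M : lmodType k) (act : nat -> M -> M) n (g : 'I_n -> M)
    (f : 'I_n -> seq k) : M :=
  \sum_(j < n) Dact act (f j) (g j).

Definition fin_pres (M : lmodType k) (act : nat -> M -> M) : Prop :=
  exists n (g : 'I_n -> M),
    (forall x : M, exists f : 'I_n -> seq k, Dev act g f = x) /\
    exists m (r : 'I_m -> 'I_n -> seq k),
      (forall l, Dev act g (r l) = 0) /\
      (forall f : 'I_n -> seq k, Dev act g f = 0 ->
         exists h : 'I_m -> seq k,
           forall j i, (f j)`_i = \sum_(l < m) (Dmul (h l) (r l j))`_i).

Definition graded (M : lmodType k) (act : nat -> M -> M)
    (hom : int -> M -> Prop) : Prop :=
  [/\ (forall d, hom d 0),
      (forall d x y, hom d x -> hom d y -> hom d (x + y)) &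
      (forall d (a : k) x, hom d x -> hom d (a *: x))] /\
  [/\
  (forall x : M, exists (s : seq int) (f : int -> M),
          [/\ uniq s, forall e, hom e (f e) & x = \sum_(e <- s) f e]),
      (forall (s : seq int) (f : int -> M), uniq s -> (forall e, hom e (f e)) ->
          \sum_(e <- s) f e = 0 -> forall e, e \in s -> f e = 0) &
      (forall n d x, hom d x -> hom (d + (n%:Z))%R (act n x))].

Definition is_torsion (M : lmodType k) (act : nat -> M -> M) (x : M) : Prop :=
  exists N, forall n, (N <= n)%N -> act n x = 0.

Definition torsion_free (M : lmodType k) (act : nat -> M -> M) : Prop :=
  forall x : M, is_torsion act x -> x = 0.

Definition condB : Prop :=
  forall Mx : k -> Prop, maximal_ideal Mx ->
    forall N, exists n, (N <= n)%N /\ Mx (pi n).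

End GDPA.

(* Main.v *)
(* (b) => (a): localise at a maximal ideal containing the annihilator of a
   torsion element and rescale the basis, so that pi_n = 1 except for n in an
   infinite chain of divisibility h = h_0 | h_1 | ..., where 1 - c pi_n is
   always a unit.  If h exceeds the degrees of the relations, the module is the
   cokernel of a pencil: finitely supported sequences w in a finite free
   k-module N, modulo the sequences al (rho_q) + lam_q be (rho_(q-1)), where
   lam_q is the product of the pi_(h_i) with i >= 1 and h_i %| h q.  Keeping in
   lam only the indices i <= t gives a module M_t over k[y_t], y_t = x^[h_t].
   Its y_t-torsion consists of elements P_t z of degree 0, with z in N and P_t
   the product of the first t factors pi_(h_i); since the submodules
   {z | P_t z = 0 in M_t} of N stabilise, y_t kills the y_t-torsion of M_t for
   large t.  At such a level, writing that x^[h_s] w = 0 block by block gives,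
   for every s, a terminating chain y_t c_(q+1) = nu_q c_q starting from w, up
   to an error in P_s N that does not depend on s and hence vanishes by
   Krull's argument.  Comparing the chains for two values of s yields one that
   terminates for the coefficients nu_q of the module itself, so w = 0.

   (a) => (b): if pi_n is outside a maximal ideal P for all n >= N, then
   C(n, N!) is outside P for n > N!, so that x^[1], ..., x^[N!] generate the
   x^[n] with n >= 1 modulo P, and k/P, with x^[n] acting by 0 for n >= 1, is a
   finitely presented torsion module. *)
Require Import Defs.
From HB Require Import structures.
From mathcomp Require Import all_boot all_order all_algebra.
From mathcomp Require Import boolp functions.
From mathcomp Require Import zify ring.
Set Implicit Arguments. Unset Strict Implicit. Unset Printing Implicit Defensive.
Import GRing.Theory.
Local Open Scope ring_scope.

(** * Pencils of sequences *)

Section Sequences.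
Variables (A : comPzRingType) (V : lmodType A).
Implicit Types (z : V) (w : nat -> V).

Definition finsupp w := exists B, forall q, (B <= q)%N -> w q = 0.

Definition dl m z : nat -> V := fun q => if q == m then z else 0.

Definition sh m w : nat -> V := fun q => if (q < m)%N then 0 else w (q - m)%N.

Arguments dl m%_N z _%_N.
Arguments sh m%_N w _%_N.

Lemma dlD m z z' : dl m (z + z') = dl m z + dl m z'.
Proof. by apply/funext => q; rewrite addrfctE /dl; case: ifP => // _; rewrite addr0. Qed.

Lemma dlZ m a z : dl m (a *: z) = a *: dl m z.
Proof. by apply/funext => q; rewrite scalrfctE /dl; case: ifP => // _; rewrite scaler0. Qed.

Lemma dlN m z : dl m (- z) = - dl m z.
Proof. by rewrite -scaleN1r dlZ scaleN1r. Qed.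

Lemma dlB m z z' : dl m (z - z') = dl m z - dl m z'.
Proof. by rewrite dlD dlN. Qed.

Lemma dl0 m : dl m 0 = 0.
Proof. by apply/funext => q; rewrite /dl; case: ifP. Qed.

Lemma shD m w w' : sh m (w + w') = sh m w + sh m w'.
Proof. by apply/funext => q; rewrite /sh !addrfctE; case: ifP => _; rewrite ?addr0. Qed.

Lemma shZ m a w : sh m (a *: w) = a *: sh m w.
Proof. by apply/funext => q; rewrite /sh !scalrfctE; case: ifP => _; rewrite ?scaler0. Qed.

Lemma shB m w w' : sh m (w - w') = sh m w - sh m w'.
Proof. by rewrite -scaleN1r shD shZ scaleN1r. Qed.

Lemma sh_dl m i z : sh m (dl i z) = dl (m + i) z.
Proof.
apply/funext => q; rewrite /sh /dl.
case: ltnP => h; first by case: eqP => // e; lia.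
by case: eqP => e; case: eqP => // e'; lia.
Qed.

Lemma sh_sh m i w : sh m (sh i w) = sh (m + i) w.
Proof.
apply/funext => q; rewrite /sh.
case: ltnP => h; first by rewrite ifT //; lia.
case: ltnP => h1; first by rewrite ifT //; lia.
by rewrite ifF ?subnDA //; lia.
Qed.

Lemma sh0 w : sh 0 w = w.
Proof. by apply/funext => q; rewrite /sh subn0. Qed.

Lemma finsuppD a w w' : finsupp w -> finsupp w' -> finsupp (a *: w + w').
Proof.
move=> [B HB] [C HC]; exists (maxn B C) => q; rewrite geq_max => /andP[h h'].
by rewrite addrfctE scalrfctE HB // HC // scaler0 addr0.
Qed.

End Sequences.
Arguments dl {A V} m%_N z _%_N.
Arguments sh {A V} m%_N w _%_N.

Section Pencil.
Variables (A : comPzRingType) (N R : lmodType A) (al be : {linear R -> N}).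
Implicit Types (lam mu : nat -> A) (z : N) (w : nat -> N) (rho : nat -> R).

(** With basis elements y_q such that y_1 y_(q-1) = lam_q y_q, this is the image of rho under al +
    y_1 be. *)
Definition bd lam rho : nat -> N := fun q =>
  al (rho q) + (if q is q'.+1 then lam q *: be (rho q') else 0).

Lemma bd0 lam rho : bd lam rho 0 = al (rho 0).
Proof. by rewrite /bd addr0. Qed.

Lemma bdS lam rho q :
  (0 < q)%N -> bd lam rho q = al (rho q) + lam q *: be (rho q.-1).
Proof. by case: q. Qed.

Definition im lam w := exists2 rho, finsupp rho & w = bd lam rho.

Lemma im_lin lam a w w' : im lam w -> im lam w' -> im lam (a *: w + w').
Proof.
move=> [rho hrho ->] [rho' hrho' ->]; exists (a *: rho + rho').
  exact: finsuppD.
apply/funext => -[|q].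
  by rewrite addrfctE scalrfctE !bd0 addrfctE scalrfctE linearP.
rewrite addrfctE scalrfctE !bdS // addrfctE scalrfctE !linearP /=.
by rewrite !scalerDr !scalerA [a * _]mulrC addrACA.
Qed.

Lemma im0 lam : im lam 0.
Proof.
exists 0; first by exists 0.
by apply/funext => -[|q]; rewrite ?bd0 ?bdS //= !linear0 ?scaler0 ?addr0.
Qed.

Lemma imD lam w w' : im lam w -> im lam w' -> im lam (w + w').
Proof. by move=> h; rewrite -[w]scale1r; exact: im_lin. Qed.

Lemma imZ lam a w : im lam w -> im lam (a *: w).
Proof. by move=> h; rewrite -[_ *: _]addr0; apply: im_lin => //; exact: im0. Qed.

Lemma imN lam w : im lam w -> im lam (- w).
Proof. by rewrite -scaleN1r; exact: imZ. Qed.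

Lemma imB lam w w' : im lam w -> im lam w' -> im lam (w - w').
Proof. by move=> h h'; apply: imD => //; exact: imN. Qed.

Lemma im_congr lam w w' : im lam (w - w') -> im lam w' -> im lam w.
Proof. by move=> h h'; rewrite -[w](subrK w'); exact: imD. Qed.

Lemma im_congrC lam w w' : im lam (w - w') -> im lam (w' - w).
Proof. by move=> h; rewrite -opprB; exact: imN. Qed.

(** Multiplication by a basis element of degree m whose product with the one of degree j has
    structure constant mu_1 ... mu_j. For m = 0 it compares two coefficient sequences. *)
Definition rescale mu m w : nat -> N := fun q =>
  if (q < m)%N then 0 else (\prod_(1 <= i < (q - m).+1) mu i) *: w (q - m)%N.

Arguments rescale mu m%_N w _%_N.

Lemma rescaleD mu m w w' : rescale mu m (w + w') = rescale mu m w + rescale mu m w'.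
Proof.
apply/funext => q; rewrite /rescale !addrfctE.
by case: ifP => _; rewrite ?addr0 ?scalerDr.
Qed.

Lemma rescaleB mu m w w' : rescale mu m (w - w') = rescale mu m w - rescale mu m w'.
Proof.
apply/funext => q; rewrite /rescale !addrfctE !opprfctE.
by case: ifP => _; rewrite ?subr0 ?scalerDr ?scalerN.
Qed.

Lemma rescale_dl mu m i z :
  rescale mu m (dl i z) = dl (m + i) ((\prod_(1 <= j < i.+1) mu j) *: z).
Proof.
apply/funext => q; rewrite /rescale /dl.
case: ltnP => h; first by case: eqP => // e; lia.
case: eqP => e.
  by rewrite e; case: eqP => // ?; lia.
by rewrite scaler0; case: eqP => // ?; lia.
Qed.

(** Consecutive weights differ by the factor [mu j], which is exactly what the carry coefficient
    gains. The case j = 0 is excluded because no carry enters degree m. *)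
Lemma im_rescale lam lam' mu m w :
  (forall j, (0 < j)%N -> lam' (m + j)%N = lam j * mu j) ->
  im lam w -> im lam' (rescale mu m w).
Proof.
move=> hmu [rho [B hB] ->].
exists (fun q => if (q < m)%N then 0
  else (\prod_(1 <= i < (q - m).+1) mu i) *: rho (q - m)%N).
  exists (B + m)%N => q hq; rewrite ifF; last by lia.
  by rewrite hB ?scaler0 //; lia.
apply/funext => q; rewrite /rescale; case: ltnP => h.
  case: q h => [|q] h; first by rewrite bd0 h linear0.
  by rewrite bdS // h /= ifT ?linear0 ?scaler0 ?addr0 //; lia.
case: q h => [|q] h.
  have -> : m = 0%N by lia.
  by rewrite !bd0 /= !big_geq // !scale1r.
rewrite (bdS _ _ (ltn0Sn q)) /= (ltnNge q.+1) h /=.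
case: (ltnP q m) => h'.
  have -> : (q.+1 - m = 0)%N by lia.
  by rewrite bd0 !big_geq // !scale1r linear0 scaler0 addr0.
have -> : (q.+1 - m = (q - m).+1)%N by lia.
rewrite bdS //= !linearZ /= scalerDr; congr (_ + _).
have -> : q.+1 = (m + (q - m).+1)%N by lia.
rewrite hmu // big_nat_recr //= !scalerA; congr (_ *: _); ring.
Qed.

(* A partial chain (rho_q) for q < m carries its head [al rho_0] at degree 0
   to its tail at degree m. *)
Lemma descent lam mu m rho :
  (0 < m)%N ->
  (forall q, (0 < q < m)%N ->
     al (rho q) + (lam q * mu q) *: be (rho q.-1) = 0) ->
  im lam (dl m (lam m *: be (rho m.-1))
          + (\prod_(1 <= i < m) mu i) *: dl 0 (al (rho 0))).
Proof.
(* Weighting rho_q by the mu_i with q < i < m turns a chain for lam * mu into one for lam. *)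
move=> m0 h; exists (fun q => if (q < m)%N then (\prod_(q.+1 <= i < m) mu i) *: rho q else 0).
  by exists m => q hq; rewrite ifF //; lia.
apply/funext => -[|q]; rewrite addrfctE scalrfctE /dl.
  by rewrite bd0 m0 eqxx linearZ /= ifF ?add0r //; lia.
rewrite bdS //= scaler0 addr0; case: eqP => e.
  by rewrite -e ltnn ltnSn linear0 add0r big_geq // scale1r.
case: (ltnP q.+1 m) => h1; last first.
  by rewrite ifF ?linear0 ?scaler0 ?addr0 //; lia.
rewrite ifT; last by lia.
rewrite [X in _ *: (be (X *: _))]big_ltn // !linearZ /= !scalerA.
have := h q.+1; rewrite h1 => /(_ isT) /= /(congr1 (fun x => (\prod_(q.+2 <= i < m) mu i) *: x)).
rewrite scaler0 scalerDr scalerA => <-; congr (_ + _); congr (_ *: _); ring.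
Qed.

End Pencil.
Arguments rescale {A N} mu m%_N w _%_N.

(** * Noetherian modules and Krull's argument *)

Definition submodule (A : comPzRingType) (V : lmodType A) (K : V -> Prop) :=
  K 0 /\ forall a x y, K x -> K y -> K (a *: x + y).

Definition acc (A : comPzRingType) (V : lmodType A) :=
  forall K : nat -> V -> Prop, (forall i, submodule (K i)) ->
    (forall i x, K i x -> K i.+1 x) -> exists i0, forall i x, K i x -> K i0 x.

Section SubmoduleTheory.
Variables (A : comPzRingType) (V : lmodType A).
Implicit Types (K : V -> Prop).

Lemma submoduleD K x y : submodule K -> K x -> K y -> K (x + y).
Proof. by move=> [_ h] hx hy; rewrite -[x]scale1r; apply: h. Qed.

Lemma submoduleZ K a x : submodule K -> K x -> K (a *: x).
Proof. by move=> [h0 h] hx; rewrite -[_ *: _]addr0; apply: h. Qed.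

Lemma submoduleB K x y : submodule K -> K x -> K y -> K (x - y).
Proof. by move=> hK hx hy; rewrite -[- y]scaleN1r; apply: submoduleD => //; apply: submoduleZ. Qed.

Lemma chain_le (T : Type) (K : nat -> T -> Prop) i j x :
  (forall i x, K i x -> K i.+1 x) -> (i <= j)%N -> K i x -> K j x.
Proof. by move=> h /subnK <- Kx; elim: (j - i)%N => // m; exact: h. Qed.

(* Krull's argument: once the annihilators of the partial products stabilise,
   u determines elements v_i with v_i = p_i v_(i+1) modulo K, and the chain of
   submodules K + A v_i stabilises, so that (1 - c p_i) v_(i+1) is in K. *)
Lemma krull (p : nat -> A) K u t :
  acc V -> submodule K -> (forall i c, exists d, d * (1 - c * p i) = 1) ->
  (forall s, (t <= s)%N -> exists z, K (u - (\prod_(0 <= i < s) p i) *: z)) ->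
  K u.
Proof.
move=> accV hK hp hu; set P := fun s => \prod_(0 <= i < s) p i.
have PS s : P s.+1 = P s * p s by rewrite /P big_nat_recr.
have Ksub i : submodule (fun x => K (P i *: x)).
  split; first by rewrite scaler0; case: hK.
  move=> a x y hx hy; rewrite scalerDr scalerA mulrC -scalerA.
  by case: hK => _; apply.
have Kmon i x : K (P i *: x) -> K (P i.+1 *: x).
  by move=> h; rewrite PS mulrC -scalerA; exact: submoduleZ.
have [s0 hs0] := accV _ Ksub Kmon.
pose s1 := maxn s0 t.
have hs1 i x : K (P i *: x) -> K (P s1 *: x).
  move=> /hs0 h; apply: (@chain_le _ (fun i x => K (P i *: x)) s0) => //.
  exact: leq_maxl.
have [z hz] : exists z : nat -> V, forall i, K (u - P (s1 + i)%N *: z i).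
  suff /boolp.choice [z hz] : forall i, exists y, K (u - P (s1 + i)%N *: y).
    by exists z.
  move=> i; apply: hu.
  exact: leq_trans (leq_maxr _ _) (leq_addr _ _).
pose v i := P s1 *: z i.
have hv i : K (v i - p (s1 + i)%N *: v i.+1).
  rewrite /v scalerA mulrC -scalerA -scalerBr; apply: (hs1 (s1 + i)%N).
  rewrite scalerBr scalerA -PS -addnS.
  have -> : P (s1 + i)%N *: z i - P (s1 + i.+1)%N *: z i.+1
     = (u - P (s1 + i.+1)%N *: z i.+1) - (u - P (s1 + i)%N *: z i).
    by rewrite opprB [RHS]addrC addrA subrK.
  exact: submoduleB.
pose L i x := exists c, K (x - c *: v i).
have Lsub i : submodule (L i).
  split; first by exists 0; rewrite scale0r subr0; case: hK.
  move=> a x y [c hc] [d hd]; exists (a * c + d).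
  have -> : a *: x + y - (a * c + d) *: v i = a *: (x - c *: v i) + (y - d *: v i).
    by rewrite scalerBr scalerDl -scalerA opprD addrACA.
  by case: hK => _; apply.
have Lmon i x : L i x -> L i.+1 x.
  move=> [c hc]; exists (c * p (s1 + i)%N).
  have -> : x - (c * p (s1 + i)%N) *: v i.+1
      = c *: (v i - p (s1 + i)%N *: v i.+1) + (x - c *: v i).
    by rewrite scalerBr -scalerA [RHS]addrC addrA subrK.
  by case: hK => _; apply.
have [i0 hi0] := accV _ Lsub Lmon.
have [c hc] : L i0 (v i0.+1).
  apply: (hi0 i0.+1); exists 1; rewrite scale1r subrr; by case: hK.
have [d hd] := hp (s1 + i0)%N c.
have : K (d *: ((v i0.+1 - c *: v i0) + c *: (v i0 - p (s1 + i0)%N *: v i0.+1))).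
  by apply: submoduleZ => //; apply: submoduleD => //; apply: submoduleZ.
rewrite scalerBr addrA subrK scalerA -{1}[v i0.+1]scale1r -scalerBl scalerA hd scale1r.
(* The factors from s1 on complete P s1 to the full product, to which u is congruent modulo K. *)
rewrite /v => /(submoduleZ (\prod_(s1 <= i < s1 + i0.+1) p i) hK).
rewrite scalerA mulrC /P -big_cat_nat ?leq_addr // => h.
by rewrite -[u](subrK (P (s1 + i0.+1)%N *: z i0.+1)); apply: submoduleD.
Qed.

End SubmoduleTheory.

(** * Torsion in the cokernel of a pencil over a divisibility chain *)

Section Tower.
Variables (A : comPzRingType) (p : nat -> A) (n : nat -> nat).
Hypotheses (n0 : n 0 = 1%N) (nS : forall i, (n i %| n i.+1)%N)
  (nlt : forall i, (n i < n i.+1)%N).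

(* The coefficient lam_q truncated at level t is nu 0 t q; nuI s q is the limit
   of nu s t q for large t, as i < n i bounds the divisors n i of q > 0. *)
Definition nu s t q : A := \prod_(s <= i < t | (n i.+1 %| q)%N) p i.
Arguments nu (s t q)%_N.
Local Notation P s t := (\prod_(s <= i < t) p i).

Lemma n_dvd i j : (i <= j)%N -> (n i %| n j)%N.
Proof. by move=> /subnK <-; elim: (j - i)%N => // m /dvdn_trans; apply. Qed.

Lemma n_le i j : (i <= j)%N -> (n i <= n j)%N.
Proof. by move=> /subnK <-; elim: (j - i)%N => // m /leq_trans; apply; apply: ltnW. Qed.

Lemma n_gt i : (i < n i)%N.
Proof. by elim: i => [|i IH]; rewrite ?n0 //; apply: leq_ltn_trans IH _. Qed.

Lemma n_gt0 i : (0 < n i)%N.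
Proof. exact: leq_ltn_trans (n_gt i). Qed.

Lemma nu_cat s t u q : (s <= t)%N -> (t <= u)%N -> nu s u q = nu s t q * nu t u q.
Proof. by move=> h h'; rewrite /nu (@big_cat_nat _ _ _ t). Qed.

Lemma nu_shift s t m q : (n t %| m)%N -> nu s t (m + q) = nu s t q.
Proof.
move=> h; rewrite /nu big_nat_cond [RHS]big_nat_cond; apply: eq_bigl => i.
case: (leqP s i) => //= _; case: (ltnP i t) => //= it.
by rewrite dvdn_addr // (dvdn_trans _ h) // n_dvd.
Qed.

Lemma nu_mult s t m : (n t %| m)%N -> nu s t m = P s t.
Proof.
move=> h; rewrite /nu big_nat_cond [RHS]big_nat_cond; apply: eq_bigl => i.
case: (leqP s i) => //= _; case: (ltnP i t) => //= it.
by rewrite (dvdn_trans _ h) // n_dvd.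
Qed.

Lemma nu_small s t q : (0 < q < n s.+1)%N -> nu s t q = 1.
Proof.
move=> /andP[q0 h]; rewrite /nu big_nat_cond big1 // => i /andP[/andP[si _]].
move=> /(dvdn_leq q0) => h'; have := @n_le s.+1 i.+1 si; lia.
Qed.

Lemma nu_ge s t q : (0 < q <= s)%N -> nu s t q = 1.
Proof. by move=> /andP[q0 h]; apply: nu_small; rewrite q0 /=; have := n_gt s.+1; lia. Qed.

Definition nuI s q : A := nu s (s + q) q.
Arguments nuI (s q)%_N.

Lemma nuI_eq s q t : (0 < q)%N -> (s + q <= t)%N -> nuI s q = nu s t q.
Proof.
move=> q0 h; rewrite (@nu_cat s (s + q) t) ?leq_addr //.
by rewrite (@nu_ge (s + q)) ?mulr1 // q0 leq_addl.
Qed.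

Lemma nuI_split s t q : (0 < q)%N -> (s <= t)%N -> nuI s q = nu s t q * nuI t q.
Proof.
move=> q0 st; rewrite (@nuI_eq s q (t + q)) //; last by rewrite leq_add2r.
by rewrite (@nu_cat s t) ?leq_addr.
Qed.

(** A divisor n (i+1) with i < s divides n s, so it does not see the shift. One with i >= s divides
    neither argument, since n (s+1) >= 2 n s > n s + q. *)
Lemma nuI_shift t s q : (t <= s)%N -> (0 < q < n s)%N -> nuI t (n s + q) = nuI t q.
Proof.
move=> ts /andP[q0 h].
rewrite (@nuI_split t s) ?addn_gt0 ?n_gt0 // (@nuI_split t s q) //.
rewrite nu_shift // /nuI [nu s (s + q) q]nu_small; last first.
  by rewrite q0 (ltn_trans h) // nlt.
congr (_ * _); rewrite /nu big_nat_cond big1 // => i /andP[/andP[si _] d].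
have d1 : (n s.+1 %| n s + q)%N by apply: dvdn_trans d; apply: n_dvd.
have /dvdnP[e he] := nS s.
have e2 : (2 <= e)%N by have := nlt s; have := n_gt0 s; nia.
have : (n s.+1 <= n s + q)%N by apply: dvdn_leq => //; lia.
by rewrite he; nia.
Qed.

Variables (N R : lmodType A) (al be : {linear R -> N}).
Implicit Types (z : N) (w : nat -> N).
Local Notation im := (im al be).
Local Notation lam := (nu 0).
Local Notation LAM := (nuI 0).

(** All n i with i <= t divide n t, so the coefficients at level t have period n t, and
    multiplication by y_t is a plain shift. *)
Lemma im_sh t m w : (n t %| m)%N -> im (lam t) w -> im (lam t) (sh m w).
Proof.
move=> tm /(@im_rescale _ _ _ _ _ (lam t) (lam t) (fun=> 1) m).
have -> : rescale (fun=> 1) m w = sh m w.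
  by apply/funext => q; rewrite /rescale /sh; case: ifP => // _; rewrite big1 // scale1r.
by apply=> j _; rewrite nu_shift // mulr1.
Qed.

Lemma im_dl_le t i j z :
  (i <= j)%N -> im (lam t) (dl (i * n t) z) -> im (lam t) (dl (j * n t) z).
Proof.
move=> ij h; have := im_sh (dvdn_mull (j - i) (dvdnn (n t))) h.
by rewrite sh_dl -mulnDl subnK.
Qed.

(** The shift is undone one block at a time. The first block of the relation is a partial chain with
    head al rho_0 = - P_t z', where z' comes from the induction hypothesis. Its carry out of the
    block is P_t z at level t, and [descent] at level s makes P_s z, in degree n t, a multiple of
    P_s z' in degree 0, so torsion passes from z' to z. *)
Lemma torsion_repr s t w j :
  (s <= t)%N -> im (lam t) (sh (j * n t) w) ->
  exists z, (exists i, im (lam s) (dl (i * n s) (P 0 s *: z))) /\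
            im (lam t) (w - dl 0 (P 0 t *: z)).
Proof.
move=> st; elim: j w => [|j IH] w.
  rewrite mul0n sh0 => h; exists 0; rewrite !scaler0 dl0 subr0; split=> //.
  by exists 0%N; rewrite dl0; exact: im0.
rewrite mulSn addnC -sh_sh => /IH[z' [[i hi] [rho [B hB] e]]].
have nt := n_gt0 t.
have Pst : P 0 t = P 0 s * P s t by rewrite -big_cat_nat.
have h0 : al (rho 0%N) = - (P 0 t *: z').
  by rewrite -(bd0 al be (lam t)) -e addrfctE opprfctE /sh nt /dl eqxx sub0r.
have hq q : (0 < q < n t)%N -> al (rho q) + lam t q *: be (rho q.-1) = 0.
  move=> /andP[q0 qn]; rewrite -bdS // -e addrfctE opprfctE /sh qn /dl.
  by rewrite eqn0Ngt q0 subr0.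
exists (be (rho (n t).-1)); split.
  exists (i + n t %/ n s)%N.
  have := @descent _ _ _ al be (lam s) (nu s t) (n t) rho nt.
  rewrite nu_mult ?n_dvd // => h.
  have h1 q (hqn : (0 < q < n t)%N) :
      al (rho q) + (lam s q * nu s t q) *: be (rho q.-1) = 0.
    by rewrite -nu_cat //; exact: hq.
  have := im_sh (dvdn_mull i (dvdnn (n s))) (h h1).
  rewrite shD shZ !sh_dl addn0 mulnDl divnK ?n_dvd // => h2.
  rewrite -[dl _ _](addrK ((\prod_(1 <= k < n t) nu s t k) *: dl (i * n s) (al (rho 0%N)))).
  apply: imB h2 _; apply: imZ.
  have -> : al (rho 0%N) = (- P s t) *: (P 0 s *: z').
    by rewrite h0 Pst scalerA mulNr scaleNr mulrC.
  rewrite dlZ; exact: imZ.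
exists (fun q => rho (n t + q)%N).
  by exists B => q hq'; rewrite hB //; lia.
apply/funext => q; have := congr1 (@^~ (n t + q)%N) e.
rewrite addrfctE opprfctE {1}/sh ltnNge leq_addr /= addKn.
rewrite /dl addn_eq0 (gtn_eqF nt) /= subr0 => eq.
rewrite addrfctE opprfctE /dl eq bdS ?addn_gt0 ?nt //.
case: q eq => [|q] eq.
  by rewrite bd0 /= addn0 nu_mult // addrK.
by rewrite subr0 bdS // nu_shift // addnS.
Qed.

Lemma im_dl_submodule lam' m c : submodule (fun z => im lam' (dl m (c *: z))).
Proof.
split; first by rewrite scaler0 dl0; exact: im0.
move=> a x y hx hy; rewrite scalerDr scalerA mulrC -scalerA dlD dlZ.
exact: im_lin.
Qed.

Lemma im_dl0_le s t z : (s <= t)%N -> im (lam s) (dl 0 z) -> im (lam t) (dl 0 z).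
Proof.
move=> st /(@im_rescale _ _ _ _ _ (lam s) (lam t) (nu s t) 0).
rewrite rescale_dl big_geq // scale1r; apply=> j _.
by rewrite add0n (@nu_cat 0 s t).
Qed.

Definition annP t z := im (lam t) (dl 0 (P 0 t *: z)).

Lemma annP_submodule t : submodule (annP t).
Proof. exact: im_dl_submodule. Qed.

Lemma annPS t z : annP t z -> annP t.+1 z.
Proof.
rewrite /annP => h.
have -> : P 0 t.+1 *: z = p t *: (P 0 t *: z) by rewrite big_nat_recr // scalerA mulrC.
by rewrite dlZ; apply: imZ; apply: im_dl0_le h.
Qed.

(* y_t kills the y_t-torsion of the truncation at level t. *)
Definition good t := forall w j,
  im (lam t) (sh (j * n t) w) -> im (lam t) (sh (n t) w).

(** At a level s where [annP] is stationary, a single power y_s^a kills all torsion in degree 0. If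
    n t exceeds a n_s, a torsion element w is P_t z with P_s z killed by y_s^a, which yields Q y_t w
    = 0 for a product Q of elements p_k with k >= s. Such p_k cancel on P_t N by stationarity. *)
Lemma good_levels : acc N -> exists T, forall t, (T <= t)%N -> good t.
Proof.
move=> accN.
have [s hs] := accN _ annP_submodule annPS.
have annPE i j z : (s <= j)%N -> annP i z -> annP j z.
  by move=> sj /hs; apply: chain_le sj; exact: annPS.
have [a ha] : exists a, forall i z,
    im (lam s) (dl (i * n s) z) -> im (lam s) (dl (a * n s) z).
  have := accN (fun i z => im (lam s) (dl (i * n s) z)).
  apply=> [i|i z].
    have [h1 h2] := im_dl_submodule (lam s) (i * n s) 1.
    split=> [|b x y hx hy]; first by rewrite scaler0 in h1.
    by move: (h2 b x y); rewrite !scale1r; apply.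
  exact: im_dl_le.
exists (maxn s (a * n s)) => t; rewrite geq_max => /andP[st at_] w j h.
have Pst : P 0 t = P s t * P 0 s by rewrite mulrC -big_cat_nat.
have [z [[i /ha hi] hz]] := torsion_repr st h.
have aE : (a <= n t %/ n s)%N.
  by rewrite leq_divRL ?n_gt0 // (leq_trans at_) // ltnW // n_gt.
(* Passing from level s to level t multiplies degree n t by Q and by the p_i with s <= i < t; the
   latter complete P 0 s to P 0 t. *)
pose Q := \prod_(1 <= q < n t) nu s t q.
have hQ : im (lam t) (Q *: sh (n t) w).
  have h1 := im_dl_le aE hi; rewrite divnK ?n_dvd // in h1.
  have := @im_rescale _ _ _ _ _ (lam s) (lam t) (nu s t) 0 _ _ h1.
  rewrite rescale_dl add0n big_nat_recr ?n_gt0 //= nu_mult //.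
  rewrite -/Q scalerA -mulrA -Pst -scalerA dlZ => h2.
  have := im_sh (dvdnn (n t)) hz; rewrite shB sh_dl addn0 => /(imZ Q).
  rewrite scalerBr => h3; apply: im_congr h3 _; apply: h2 => q _.
  by rewrite add0n (@nu_cat 0 s t).
have h5 : im (lam t) (sh (j * n t) (sh (n t) w)).
  by rewrite sh_sh addnC -sh_sh; apply: im_sh.
have [z' [_ hz']] := torsion_repr st h5.
apply: im_congr (hz') _.
(* [reg c] says that c cancels on elements P_t v of degree 0. For p_k with s <= k < t, the
   stationary annihilator is read at level k, where P_k p_k = P_(k+1). *)
pose reg c := forall v, im (lam t) (dl 0 (c *: (P 0 t *: v))) -> annP t v.
have reg1 : reg 1 by move=> v; rewrite scale1r.
have regM c d : reg c -> reg d -> reg (c * d).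
  move=> hc hd v; rewrite -scalerA [d *: _]scalerA [d * _]mulrC -scalerA => /hc.
  by rewrite /annP scalerA mulrC -scalerA => /hd.
have regQ : reg Q.
  apply: big_ind => // q _; rewrite /nu big_nat_cond.
  apply: big_ind => // k /andP[/andP[sk kt] _] v.
  rewrite scalerA mulrC -scalerA => /(annPE _ k _ sk).
  rewrite /annP scalerA -big_nat_recr // => /(im_dl0_le (leqnSn k)).
  by move=> /(annPE k.+1); apply.
apply: regQ; rewrite dlZ.
have := imZ Q hz'; rewrite scalerBr => /im_congrC h4.
exact: im_congr h4 hQ.
Qed.

Lemma nuI_ndvd t m : ~~ (n t %| m)%N -> nuI t m = 1.
Proof.
move=> h; rewrite /nuI /nu big_nat_cond big1 // => i /andP[/andP[ti _] d].
by case/negP: h; apply: dvdn_trans d; apply: n_dvd; exact: leqW.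
Qed.

Lemma nuI_top s t : (s <= t)%N -> nuI s (n t) = P s t.
Proof.
move=> st; rewrite (@nuI_split s t) ?n_gt0 // nu_mult // /nuI nu_small ?mulr1 //.
by rewrite n_gt0 nlt.
Qed.

(** * Chains of blocks at a level whose torsion is killed by y_t *)

Section Level.
Variable t : nat.
Hypothesis goodt : good t.
Let nt := n t.
Let nt0 : (0 < nt)%N := n_gt0 t.
Local Notation imt := (im (lam t)).
(** The equation c = y_t c' in the truncation at level t. *)
Local Notation "c '~>' c'" := (imt (dl 0 c - dl nt c')) (at level 70).

Lemma good_dl j z : imt (dl (j * nt) z) -> imt (dl nt z).
Proof.
move=> h; have := @goodt (dl 0 z) j; rewrite !sh_dl !addn0; exact.
Qed.

Lemma step_sh j c c' :
  c ~> c' -> imt (dl (j * nt) c - dl (j.+1 * nt) c').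
Proof.
move=> h; have := im_sh (dvdn_mull j (dvdnn (n t))) h.
by rewrite shB !sh_dl addn0 mulSn addnC.
Qed.

(** Here y_t^2 c' = y_t c = 0, and at a good level a single y_t already kills c'. *)
Lemma step_torsion c c' : c ~> c' -> imt (dl nt c) -> imt (dl nt c').
Proof.
move=> /(@step_sh 1%N) /im_congrC h h'; apply: (@good_dl 2%N).
by apply: im_congr h _; rewrite mul1n.
Qed.

Lemma dl_torsion z : imt (dl 0 z) -> imt (dl nt z).
Proof. by move=> h; rewrite -[nt]mul1n; apply: (@im_dl_le t 0 1). Qed.

(** The equations v_q f_q = y_t f_(q+1) multiply up: each step costs one more y_t and collects one
    more v_q on f_1. *)
Lemma steps (f : nat -> N) (v : nat -> A) m :
  (forall q, (0 < q <= m)%N -> v q *: f q ~> f q.+1) ->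
  imt (dl 0 ((\prod_(1 <= q < m.+1) v q) *: f 1%N) - dl (m * nt) (f m.+1)).
Proof.
elim: m => [|m IH] h.
  by rewrite big_geq // scale1r mul0n subrr; exact: im0.
have {}IH : imt (dl 0 ((\prod_(1 <= q < m.+1) v q) *: f 1%N) - dl (m * nt) (f m.+1)).
  by apply: IH => q /andP[q0 qm]; apply: h; rewrite q0 leqW.
have := h m.+1; rewrite leqnn => /(_ isT) /(@step_sh m) h1.
rewrite big_nat_recr //= mulrC -scalerA dlZ.
have := imD (imZ (v m.+1) IH) h1.
by rewrite scalerBr -[v _ *: dl (m * nt) _]dlZ addrA subrK.
Qed.

(* Multiplication by x^[q nt] from the truncation at level t to the module. *)
Definition phi q w := rescale (fun j => nuI t (q * nt + j)) (q * nt) w.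

Lemma im_phi q w : imt w -> im LAM (phi q w).
Proof.
apply: im_rescale => j j0.
by rewrite (@nuI_split 0 t) ?addn_gt0 ?j0 ?orbT // nu_shift ?dvdn_mull.
Qed.

(** No multiple of n t lies strictly inside a block, and [nuI t] is 1 off these multiples. *)
Lemma phi_coef q i : (i < nt)%N -> \prod_(1 <= j < i.+1) nuI t (q * nt + j) = 1.
Proof.
move=> ij; rewrite big_nat_cond big1 // => j /andP[/andP[j0 ji] _].
rewrite nuI_ndvd // dvdn_addr ?dvdn_mull //; apply/negP => /(dvdn_leq j0).
by rewrite -/nt; lia.
Qed.

Lemma phi_dl0 q z : phi q (dl 0 z) = dl (q * nt) z.
Proof. by rewrite /phi rescale_dl big_geq // scale1r addn0. Qed.

Lemma phi_dl q z : phi q (dl nt z) = dl (q.+1 * nt) (nuI t (q.+1 * nt) *: z).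
Proof.
have h : (nt.-1 < nt)%N by rewrite prednK.
have := phi_coef q h; rewrite prednK // => h1.
by rewrite /phi rescale_dl big_nat_recr //= h1 mul1r mulSn addnC.
Qed.

Lemma phi_step q c c' : c ~> c' ->
  im LAM (dl (q * nt) c - dl (q.+1 * nt) (nuI t (q.+1 * nt) *: c')).
Proof. by move=> /(im_phi q); rewrite /phi rescaleB -!/(phi _ _) phi_dl0 phi_dl. Qed.

Lemma phi_block w : (forall q, (nt <= q)%N -> w q = 0) -> phi 0 w = w.
Proof.
move=> hw; apply/funext => q; rewrite /phi /rescale mul0n ltn0 subn0.
case: (ltnP q nt) => h; last by rewrite hw // scaler0.
by have := @phi_coef 0 q h; rewrite mul0n => ->; rewrite scale1r.
Qed.

(** The relation is cut into blocks of length n t. Inside a block [LAM] agrees with the coefficients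
    at level t; at a boundary it is P_t times [nuI t]. Hence c_q, which is P_t times the carry into
    block q, enters that block with weight [nuI t (q * nt)] and leaves the preceding one as y_t c_q.
    Block E is the one that holds w. *)
Lemma torsion_chain s w : (t <= s)%N -> (forall q, (nt <= q)%N -> w q = 0) ->
  im LAM (sh (n s) w) ->
  let E := (n s %/ nt)%N in
  exists2 c : nat -> N, forall q, exists z, c q = P 0 t *: z &
  [/\ c 0%N = 0,
      exists B, forall q, (B <= q)%N -> c q = 0,
      forall q, q != E -> nuI t (q * nt) *: c q ~> c q.+1 &
      imt (w - (dl 0 (nuI t (E * nt) *: c E) - dl nt (c E.+1)))].
Proof.
move=> ts hw [rho [B hB] e] E.
have EK : (E * nt = n s)%N by rewrite divnK // n_dvd.
pose c q := P 0 t *: (if q is q'.+1 then be (rho (q * nt).-1) else 0).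
exists c; first by move=> q; rewrite /c; eexists.
pose blk q : nat -> N := fun i => if (i < nt)%N then sh (n s) w (q * nt + i)%N else 0.
have main q : imt (blk q - (dl 0 (nuI t (q * nt) *: c q) - dl nt (c q.+1))).
  exists (fun i => if (i < nt)%N then rho (q * nt + i)%N else 0).
    by exists nt => i hi; rewrite ltnNge hi.
  apply/funext => i; rewrite !(addrfctE, opprfctE) /blk e.
  case: i => [|i].
    rewrite bd0 nt0 addn0 /dl eqxx eq_sym (gtn_eqF nt0) subr0 /c.
    case: q => [|q]; first by rewrite mul0n bd0 !scaler0 subr0.
    rewrite bdS ?muln_gt0 ?nt0 // (@nuI_split 0 t) ?muln_gt0 ?nt0 //.
    by rewrite nu_mult ?dvdn_mull // scalerA [_ * P 0 t]mulrC addrK.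
  rewrite [RHS]bdS // /dl /= sub0r opprK; case: (ltngtP i.+1 nt) => h.
  - rewrite addr0 addnS bdS //; congr (_ + _ *: _).
    rewrite -addnS (@nuI_split 0 t) ?addn_gt0 ?orbT // nu_shift ?dvdn_mull //.
    rewrite [nuI t _]nuI_ndvd ?mulr1 // dvdn_addr ?dvdn_mull //.
    by apply/negP => /dvdn_leq; rewrite -/nt; lia.
  - by rewrite !linear0 ?scaler0 ?addr0.
  - rewrite linear0 !add0r h nu_mult //; congr (_ *: be (rho _)).
    by rewrite -h; lia.
split=> [||q qE|].
- by rewrite /c scaler0.
- exists B.+1 => -[//|q] hq; rewrite /c hB ?linear0 ?scaler0 //.
  by rewrite -ltnS prednK ?muln_gt0 ?nt0 //; nia.
- have := main q; suff -> : blk q = 0 by rewrite sub0r => /imN; rewrite opprK.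
  apply/funext => i; rewrite /blk; case: ifP => // hi; rewrite /sh.
  case: ltnP => // h; rewrite hw //; case: (ltngtP q E) qE => // qE _; nia.
- have := main E; suff -> : blk E = w by [].
  apply/funext => i; rewrite /blk EK /sh; case: ifP => hi.
    by rewrite ltnNge leq_addr addKn.
  by rewrite hw // leqNgt hi.
Qed.

(** By [phi q], nu_q f_q in degree q nt equals nu_(q+1) f_(q+1) in degree (q+1) nt of the module
    itself. The vanishing of the last term thus comes down to degree nt, where [phi 0] identifies
    the term with - w. *)
Lemma terminates w (f : nat -> N) r :
  (0 < r)%N -> (forall q, (nt <= q)%N -> w q = 0) ->
  imt (w + dl nt (f 1%N)) ->
  (forall q, (0 < q < r)%N -> nuI t (q * nt) *: f q ~> f q.+1) ->
  imt (dl 0 (nuI t (r * nt) *: f r)) -> im LAM w.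
Proof.
move=> r0 hw h1 hs hr.
have down j : (j < r)%N ->
    im LAM (dl ((r - j) * nt) (nuI t ((r - j) * nt) *: f (r - j)%N)).
  elim: j => [|j IH] jr.
    by rewrite subn0 -phi_dl0; exact: im_phi.
  have e : ((r - j) = (r - j.+1).+1)%N by lia.
  have h : (0 < r - j.+1 < r)%N by lia.
  have := phi_step (r - j.+1) (hs _ h); rewrite -e => h2.
  by apply: im_congr h2 _; apply: IH; lia.
have := down r.-1; rewrite prednK // leqnn => /(_ isT).
have -> : (r - r.-1 = 1)%N by lia.
move=> h2; have := im_phi 0 h1.
rewrite /phi rescaleD -!/(phi _ _) phi_block // phi_dl => h3.
by rewrite -[w](addrK (dl (1 * nt) (nuI t (1 * nt) *: f 1%N))); exact: imB.
Qed.

End Level.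

Theorem pencil_torsion w :
  acc N -> (forall i c, exists d, d * (1 - c * p i) = 1) ->
  (exists d, forall q, (d <= q)%N -> w q = 0) ->
  (exists s0, forall s, (s0 <= s)%N -> im LAM (sh (n s) w)) ->
  im LAM w.
Proof.
move=> accN hp [d hd] [s0 hs0]; have [T hT] := good_levels accN.
(* Beyond T the level is good, beyond s0 the torsion hypothesis applies, and beyond d the support of
   w lies in the first block, as t < n t. *)
pose t := maxn T (maxn s0 d).
have goodt : good t by apply: hT; exact: leq_maxl.
have hw q : (n t <= q)%N -> w q = 0.
  by move=> h; apply: hd; have := n_gt t; rewrite /t in h *; lia.
have ht s : (t <= s)%N -> im LAM (sh (n s) w) by move=> h; apply: hs0; rewrite /t in h; lia.
have nt0 := n_gt0 t.
pose imt := im (lam t).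
pose Es s := (n s %/ n t)%N.
have EK s : (t <= s)%N -> (Es s * n t = n s)%N by move=> h; rewrite divnK // n_dvd.
have YZ a z : imt (dl (n t) z) -> imt (dl (n t) (a *: z)).
  by rewrite dlZ; exact: imZ.
(* The carry of a chain at the block boundary n s is a socle element lying in
   P 0 s *: N, and it does not depend on s, so that it vanishes. *)
have head s s' : (t <= s)%N -> (t <= s')%N -> forall c c' : nat -> N,
    c 0%N = 0 -> c' 0%N = 0 ->
    (forall q, q != Es s -> imt (dl 0 (nuI t (q * n t) *: c q) - dl (n t) (c q.+1))) ->
    (forall q, q != Es s' -> imt (dl 0 (nuI t (q * n t) *: c' q) - dl (n t) (c' q.+1))) ->
    imt (w - (dl 0 (nuI t (Es s * n t) *: c (Es s)) - dl (n t) (c (Es s).+1))) ->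
    imt (w - (dl 0 (nuI t (Es s' * n t) *: c' (Es s')) - dl (n t) (c' (Es s').+1))) ->
    imt (dl 0 (nuI t (Es s * n t) *: c (Es s) - nuI t (Es s' * n t) *: c' (Es s'))).
  have tors E (c : nat -> N) : c 0%N = 0 ->
      (forall q, q != E -> imt (dl 0 (nuI t (q * n t) *: c q) - dl (n t) (c q.+1))) ->
      imt (dl (n t) (c E)).
    move=> c0 hc; suff h q : (q <= E)%N -> imt (dl (n t) (c q)) by exact: h.
    elim: q => [|q IH] qE; first by rewrite c0 dl0; exact: im0.
    apply: (step_torsion goodt (hc q _)); first by rewrite ltn_eqF.
    by apply: YZ; apply: IH; exact: ltnW.
  move=> ts ts' c c' c0 c'0 hc hc' hw1 hw2.
  have h := imB hw2 hw1.
  set u := nuI t (Es s * n t) *: c (Es s) in hw1 h *.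
  set u' := nuI t (Es s' * n t) *: c' (Es s') in hw2 h *.
  have Yu : imt (dl (n t) (u - u')).
    rewrite dlB; apply: imB; apply: YZ; [exact: tors hc|exact: tors hc'].
  have h1 : imt (dl 0 (u - u') - dl (n t) (c (Es s).+1 - c' (Es s').+1)).
    move: h; rewrite !dlB; move: (dl 0 u) (dl 0 u') (dl (n t) _) (dl (n t) _).
    move=> a b x y; rewrite [- (w - _)]opprB addrC addrA subrK.
    by rewrite !opprD addrACA -!opprD.
  exact: im_congr h1 (step_torsion goodt h1 Yu).
have Es1 : Es t = 1%N by rewrite /Es divnn nt0.
have [c hcP [c0 [B hB] hc hwc]] := torsion_chain (leqnn t) hw (ht t (leqnn t)).
rewrite -/(Es t) in hc hwc.
have PE s z : (t <= s)%N -> nuI t (Es s * n t) *: (P 0 t *: z) = P 0 s *: z.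
  by move=> ts; rewrite EK // nuI_top // scalerA mulrC -big_cat_nat.
have K0 : imt (dl 0 (nuI t (Es t * n t) *: c (Es t))).
  apply: (@krull _ _ p (fun z => imt (dl 0 z)) _ t accN _ hp) => [|s ts].
    have [h1 h2] := im_dl_submodule (lam t) 0 1.
    split=> [|a x y hx hy]; first by rewrite scaler0 in h1.
    by move: (h2 a x y); rewrite !scale1r; apply.
  have [c' hcP' [c'0 _ hc' hwc']] := torsion_chain ts hw (ht s ts).
  have [z ez] := hcP' (Es s).
  exists z; rewrite -PE // -ez.
  by apply: head (leqnn t) ts _ _ c0 c'0 hc hc' hwc hwc'.
have wE s (c' : nat -> N) : imt (dl 0 (nuI t (Es s * n t) *: c' (Es s))) ->
    imt (w - (dl 0 (nuI t (Es s * n t) *: c' (Es s)) - dl (n t) (c' (Es s).+1))) ->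
    imt (w + dl (n t) (c' (Es s).+1)).
  by move=> h1 h2; have := imD h2 h1; rewrite opprB addrA subrK.
have := wE t c K0 hwc; rewrite Es1 => w1.
(* The chain for s = t has coefficients nu_2, nu_3, ... and ends: P1 kills its
   head c_2.  A chain for large s has coefficients nu_1, nu_2, ... and the same
   head modulo y_t-torsion, so that nu_1 P1 makes it end as well. *)
pose r := B.+1.
pose P1 := \prod_(1 <= q < r) nuI t ((1 + q) * n t).
have KP1 : imt (dl 0 (P1 *: c 2%N)).
  have := @steps t (fun q => c q.+1) (fun q => nuI t ((1 + q) * n t)) B.
  rewrite /= (hB B.+2) ?dl0 ?subr0; last by lia.
  apply=> q /andP[q0 _].
  by rewrite add1n; apply: hc; rewrite Es1; lia.
pose m := r.+1.
(* Large enough that Es s > m, so that by [nuI_shift] the coefficients after block Es s repeat nu_1,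
   ..., nu_m. *)
pose s := (t + (m.+1 * n t))%N.
have ts : (t <= s)%N by exact: leq_addr.
have Em : (m < Es s)%N.
  rewrite /Es leq_divRL // ltnW //; apply: leq_ltn_trans (n_gt s).
  by rewrite leq_addl.
have [c' _ [c'0 _ hc' hwc']] := torsion_chain ts hw (ht s ts).
rewrite -/(Es s) in hc' hwc'.
have K0' : imt (dl 0 (nuI t (Es s * n t) *: c' (Es s))).
  have := head _ _ (leqnn t) ts _ _ c0 c'0 hc hc' hwc hwc'.
  by rewrite dlB => /im_congrC h; apply: im_congr h K0.
have w2 := wE s c' K0' hwc'.
pose f q := c' (Es s + q)%N.
have f1 : f 1%N = c' (Es s).+1 by rewrite /f addn1.
have shift q : (0 < q <= m)%N -> nuI t ((Es s + q) * n t) = nuI t (q * n t).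
  move=> /andP[q0 qm]; rewrite mulnDl EK // nuI_shift // muln_gt0 q0 nt0 /=.
  by rewrite -(EK s ts) ltn_pmul2r // (leq_ltn_trans qm).
have hf q : (0 < q <= m)%N ->
    imt (dl 0 (nuI t (q * n t) *: f q) - dl (n t) (f q.+1)).
  move=> hq; rewrite -shift // /f addnS; apply: hc'.
  by case/andP: hq => q0 _; apply/eqP; lia.
have Yf : imt (dl (n t) (P1 *: f 1%N)).
  have h : imt (dl (n t) (f 1%N - c 2%N)).
    rewrite dlB f1.
    have := imB w2 w1; rewrite opprD addrACA subrr add0r; exact.
  have := imD (YZ P1 _ h) (dl_torsion KP1).
  by rewrite -dlD -scalerDr subrK.
(* Along the shifted chain nu_1 P1 f_1 = y_t^r f_m. The left side is killed by y_t, so f_m is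
   torsion and y_t kills it. *)
have Yfm : imt (dl (n t) (f m)).
  have h0 q : (0 < q <= r)%N -> (0 < q <= m)%N by rewrite /m; lia.
  have := @steps t f (fun q => nuI t (q * n t)) r (fun q hq => hf q (h0 q hq)).
  move=> /(im_sh (dvdnn (n t))); rewrite shB !sh_dl addn0.
  rewrite -mulSn => /im_congrC h; apply: (@good_dl t goodt r.+1).
  apply: im_congr h _.
  rewrite big_ltn // big_add1 /= -scalerA; apply: YZ; move: Yf.
  by congr (imt (dl _ (_ *: _))).
apply: (@terminates t w f m) => //.
- by rewrite f1.
- by move=> q /andP[q0 qm]; apply: hf; rewrite q0 ltnW.
(* In nu_m f_m = y_t f_(m+1) the element f_(m+1) is again torsion, hence the right side vanishes. *)
- have hm : (0 < m <= m)%N by rewrite leqnn.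
  apply: im_congr (hf m hm) _.
  apply: (step_torsion goodt (hf m hm)).
  exact: YZ.
Qed.

End Tower.

(** * Ideals of noetherian rings *)

Section Ideals.
Variable k : comPzRingType.
Implicit Types (I J M : k -> Prop).

Lemma ideal0 I : is_ideal I -> I 0. Proof. by case. Qed.

Lemma idealD I x y : is_ideal I -> I x -> I y -> I (x + y).
Proof. by case=> _ h _; apply: h. Qed.

Lemma idealM I a x : is_ideal I -> I x -> I (a * x).
Proof. by case=> _ _ h; apply: h. Qed.

Lemma idealB I x y : is_ideal I -> I x -> I y -> I (x - y).
Proof. by move=> hI hx hy; rewrite -mulN1r; apply: idealD => //; apply: idealM. Qed.

Lemma ideal_sum I (T : finType) (F : T -> k) :
  is_ideal I -> (forall i, I (F i)) -> I (\sum_i F i).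
Proof. by move=> hI hF; apply: big_ind => //; [exact: ideal0|move=> x y; exact: idealD]. Qed.

Lemma bounded_choice (n : nat) (P : 'I_n -> nat -> Prop) :
  (forall i a b, (a <= b)%N -> P i a -> P i b) ->
  (forall i, exists a, P i a) -> exists a, forall i, P i a.
Proof.
move=> monomial /boolp.choice[a ha]; exists (\max_i a i)%N => i.
by apply: monomial (ha i); exact: leq_bigmax.
Qed.

Lemma noetherian_chain (I : nat -> k -> Prop) :
  noetherian k -> (forall i, is_ideal (I i)) ->
  (forall i x, I i x -> I i.+1 x) -> exists i0, forall i x, I i x -> I i0 x.
Proof.
move=> hk hI hS; pose U x := exists i, I i x.
have le i j x : (i <= j)%N -> I i x -> I j x by apply: chain_le.
have hU : is_ideal U.
  split; first by exists 0%N; exact: ideal0.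
    move=> x y [i hx] [j hy]; exists (maxn i j).
    by apply: idealD => //; [apply: le hx|apply: le hy]; rewrite ?leq_maxl ?leq_maxr.
  by move=> a x [i hx]; exists i; apply: idealM.
have [n [g [hg hspan]]] := hk U hU.
have [i0 hi0] : exists i0, forall i, I i0 (g i).
  by apply: bounded_choice => // i a b; exact: le.
exists i0 => i x hx; have [c ->] := hspan x (ex_intro _ i hx).
by apply: ideal_sum => // l; apply: idealM.
Qed.

(** If no maximal ideal contained I, every proper ideal above I could be strictly enlarged, and
    iterating a choice of enlargements would contradict the ascending chain condition. *)
Lemma exists_maximal I :
  noetherian k -> is_ideal I -> ~ I 1 ->
  exists M, maximal_ideal M /\ forall x, I x -> M x.
Proof.
move=> hk hI I1; apply: contrapT => hno.
pose proper J := [/\ is_ideal J, ~ J 1 & forall x, I x -> J x].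
have step J : exists J', proper J ->
    [/\ proper J', forall x, J x -> J' x & exists x, J' x /\ ~ J x].
  have [[hJ J1 IJ]|hJ] := pselect (proper J); last by exists J.
  apply: contrapT => h; apply: hno; exists J; split=> //; split=> // J' hJ' JJ'.
  have [|J'1] := pselect (J' 1); [by left|right=> x hx].
  apply: contrapT => Jx; apply: h; exists J' => _.
  by split=> //; [split=> // y /IJ /JJ'|exists x].
have [F hF] := boolp.choice step.
have pr i : proper (iter i F I) by elim: i => [//|i /hF[]].
have [i0 h0] : exists i0, forall i x, iter i F I x -> iter i0 F I x.
  apply: noetherian_chain => // i; first by case: (pr i).
  by case: (hF _ (pr i)).
have [_ _ [x [hx nx]]] := hF _ (pr i0).
by apply: nx; apply: (h0 i0.+1).
Qed.

Lemma maximal_bezout M a :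
  maximal_ideal M -> ~ M a -> exists m c, M m /\ 1 = m + c * a.
Proof.
move=> [hM M1 hmax] Ma.
have [||//|h] := hmax (fun x => exists m c, M m /\ x = m + c * a).
- split.
  + by exists 0, 0; rewrite mul0r addr0; split=> //; exact: ideal0.
  + move=> _ _ [m [c [hm ->]]] [m' [c' [hm' ->]]]; exists (m + m'), (c + c').
    by rewrite mulrDl addrACA; split=> //; exact: idealD.
  + move=> d _ [m [c [hm ->]]]; exists (d * m), (d * c).
    by rewrite mulrDr mulrA; split=> //; exact: idealM.
- by move=> x hx; exists x, 0; rewrite mul0r addr0.
- case: Ma; apply: h; exists 0, 1; rewrite mul1r add0r; split=> //; exact: ideal0.
Qed.

Lemma maximal_prime M a b :
  maximal_ideal M -> ~ M a -> ~ M b -> ~ M (a * b).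
Proof.
move=> hM Ma Mb Mab; apply: Mb; have [hI _ _] := hM.
have [m [c [hm e]]] := maximal_bezout hM Ma.
rewrite -[b]mul1r e mulrDl mulrC -mulrA.
by apply: idealD => //; apply: idealM.
Qed.

Lemma maximal_prime_prod M (T : eqType) (s : seq T) (P : pred T) (F : T -> k) :
  maximal_ideal M -> (forall i, i \in s -> P i -> ~ M (F i)) ->
  ~ M (\prod_(i <- s | P i) F i).
Proof.
move=> hM; have [_ M1 _] := hM; elim: s => [|i s IH] h; first by rewrite big_nil.
have hs : ~ M (\prod_(j <- s | P j) F j).
  by apply: IH => j js; apply: h; rewrite inE js orbT.
rewrite big_cons; case: ifP => // Pi; apply: maximal_prime => //.
by apply: h => //; exact: mem_head.
Qed.

(** Induction on the set of entries that may be nonzero: the values of one entry form a chain of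
    ideals, and the matrices vanishing there form a chain with smaller support. *)
Lemma acc_mx a b : noetherian k -> acc 'M[k]_(a, b).
Proof.
move=> hk K; set T := ('I_a * 'I_b)%type.
suff H (s : seq T) : forall K : nat -> 'M[k]_(a, b) -> Prop,
    (forall i, submodule (K i)) -> (forall i x, K i x -> K i.+1 x) ->
    (forall i x, K i x -> forall e : T, e \notin s -> x e.1 e.2 = 0) ->
    exists i0, forall i x, K i x -> K i0 x.
  move=> hK hS; refine (H (enum {: T}) K hK hS _) => i x _ e.
  by rewrite mem_enum.
elim: s => [|e s IH] {}K hK hS hsupp.
  exists 0%N => i x /hsupp h; have [K0 _] := hK 0%N.
  by suff -> : x = 0 by []; apply/matrixP => u v; rewrite mxE; apply: (h (u, v)).
have [i1 h1] : exists i1, forall i c, (exists2 x, K i x & x e.1 e.2 = c) ->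
    (exists2 x, K i1 x & x e.1 e.2 = c).
  apply: noetherian_chain => // [j|j _ [y hy <-]]; last by exists y => //; apply: hS.
  split.
  + by exists 0; rewrite ?mxE //; case: (hK j).
  + move=> _ _ [y hy <-] [z hz <-]; exists (y + z); rewrite ?mxE //.
    exact: submoduleD.
  + move=> c _ [y hy <-]; exists (c *: y); rewrite ?mxE //.
    exact: submoduleZ.
have [i2 h2] : exists i2, forall i x, K i x /\ x e.1 e.2 = 0 -> K i2 x /\ x e.1 e.2 = 0.
  apply: IH => [i|i x [hx ->]|i x [hx xe] e' he'].
  - split; first by rewrite mxE; split=> //; case: (hK i).
    move=> c x y [hx xe] [hy ye]; rewrite !mxE xe ye mulr0 addr0; split=> //.
    by case: (hK i) => _; apply.
  - by split=> //; apply: hS.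
  - case: (eqVneq e' e) => [-> //|ne]; apply: (hsupp i) => //.
    by rewrite inE negb_or ne.
have le i j x : (i <= j)%N -> K i x -> K j x by apply: chain_le.
exists (maxn i1 i2) => i x hx.
have [y hy ye] := h1 i (x e.1 e.2) (ex_intro2 _ _ x hx erefl).
rewrite -[x](subrK y); apply: submoduleD => //; last by apply: le hy; exact: leq_maxl.
(* x and y have the same entry at e, so their difference belongs to the chain with smaller
   support. *)
have [] := h2 (maxn i i1) (x - y).
  split; last by rewrite !mxE ye subrr.
  apply: submoduleB => //; [apply: le hx|apply: le hy]; first exact: leq_maxl.
  exact: leq_maxr.
by move=> h _; apply: le h; exact: leq_maxr.
Qed.

End Ideals.

(** * Localization *)

Section Localization.
Local Open Scope quotient_scope.
Variables (k : comPzRingType) (S : pred k).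
Hypotheses (S1 : S 1) (SM : forall x y, S x -> S y -> S (x * y)).

Record frac := Frac { fval :> k * k; fvalP : S fval.2 }.
HB.instance Definition _ := [isSub for fval].
HB.instance Definition _ := [Choice of frac by <:].

Definition feq (x y : frac) :=
  `[< exists2 u, S u & u * (x.1 * y.2) = u * (y.1 * x.2) >].

Lemma feqP (x y : frac) : reflect (exists2 u, S u & u * (x.1 * y.2) = u * (y.1 * x.2)) (feq x y).
Proof. exact: asboolP. Qed.

Lemma feq_equiv : equiv_class_of feq.
Proof.
split=> [x|x y|y x z]; first by apply/feqP; exists 1.
  by apply/feqP/feqP => -[u hu e]; exists u.
move=> /feqP[u hu e] /feqP[v hv e']; apply/feqP; exists (u * v * y.2).
  by rewrite !SM ?(fvalP y).
have -> : u * v * y.2 * (x.1 * z.2) = v * z.2 * (u * (x.1 * y.2)) by ring.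
rewrite e; have -> : v * z.2 * (u * (y.1 * x.2)) = u * x.2 * (v * (y.1 * z.2)) by ring.
by rewrite e'; ring.
Qed.

Canonical feq_equivRel := EquivRelPack feq_equiv.
Canonical feq_encModRel := defaultEncModRel feq.

Definition loc := {eq_quot feq}.
HB.instance Definition _ := EqQuotient.on loc.
HB.instance Definition _ := Choice.on loc.

Definition mkf (a s : k) (hs : S s) : loc := \pi_loc (@Frac (a, s) hs).

Lemma locP (x : loc) : exists a s (hs : S s), x = mkf a hs.
Proof.
rewrite -[x]reprK; case: (repr x) => -[a s] hs; exists a, s, hs.
by [].
Qed.

Lemma mkf_eq a s hs b t ht :
  (@mkf a s hs = @mkf b t ht) <-> exists2 u, S u & u * (a * t) = u * (b * s).
Proof.
split=> [/eqP|h]; first by rewrite eqmodE => /feqP.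
by apply/eqP; rewrite eqmodE; apply/feqP.
Qed.

Definition num (x : loc) := (repr x).1.
Definition den (x : loc) := (repr x).2.
Lemma denP x : S (den x). Proof. exact: fvalP (repr x). Qed.

Lemma mkfK x : mkf (num x) (denP x) = x.
Proof.
rewrite -[RHS]reprK; congr (\pi_loc _); apply: val_inj.
exact: esym (surjective_pairing _).
Qed.

Definition ladd x y := mkf (num x * den y + num y * den x) (SM (denP x) (denP y)).
Definition lmul x y := mkf (num x * num y) (SM (denP x) (denP y)).
Definition lopp x := mkf (- num x) (denP x).

Lemma num_mkf a s hs : exists2 u, S u & u * (num (@mkf a s hs) * s) = u * (a * den (mkf a hs)).
Proof. by move/mkf_eq: (mkfK (mkf a hs)). Qed.

Lemma laddE a s hs b t ht :
  ladd (@mkf a s hs) (@mkf b t ht) = mkf (a * t + b * s) (SM hs ht).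
Proof.
apply/mkf_eq; have [u hu e] := num_mkf a hs; have [v hv e'] := num_mkf b ht.
exists (u * v); first exact: SM.
set x := mkf a hs in e *; set y := mkf b ht in e' *.
transitivity (v * t * den y * (u * (num x * s)) + u * s * den x * (v * (num y * t))).
  ring.
by rewrite e e'; ring.
Qed.

Lemma lmulE a s hs b t ht :
  lmul (@mkf a s hs) (@mkf b t ht) = mkf (a * b) (SM hs ht).
Proof.
apply/mkf_eq; have [u hu e] := num_mkf a hs; have [v hv e'] := num_mkf b ht.
exists (u * v); first exact: SM.
set x := mkf a hs in e *; set y := mkf b ht in e' *.
transitivity ((u * (num x * s)) * (v * (num y * t))); first ring.
by rewrite e e'; ring.
Qed.

Lemma loppE a s hs : lopp (@mkf a s hs) = mkf (- a) hs.
Proof.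
apply/mkf_eq; have [u hu e] := num_mkf a hs; exists u => //.
by rewrite !mulNr !mulrN e.
Qed.

Let l0 := mkf 0 S1.
Let l1 := mkf 1 S1.

Local Ltac loc_tac := apply/mkf_eq; exists 1 => //; ring.

Lemma laddA : associative ladd.
Proof.
move=> x y z; have [a [s [hs ->]]] := locP x; have [b [t [ht ->]]] := locP y.
by have [c [r [hr ->]]] := locP z; rewrite !laddE; loc_tac.
Qed.

Lemma laddC : commutative ladd.
Proof.
move=> x y; have [a [s [hs ->]]] := locP x; have [b [t [ht ->]]] := locP y.
by rewrite !laddE; loc_tac.
Qed.

Lemma ladd0 : left_id l0 ladd.
Proof. by move=> x; have [a [s [hs ->]]] := locP x; rewrite laddE; loc_tac. Qed.

Lemma laddN : left_inverse l0 lopp ladd.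
Proof. by move=> x; have [a [s [hs ->]]] := locP x; rewrite loppE laddE; loc_tac. Qed.

Lemma lmulA : associative lmul.
Proof.
move=> x y z; have [a [s [hs ->]]] := locP x; have [b [t [ht ->]]] := locP y.
by have [c [r [hr ->]]] := locP z; rewrite !lmulE; loc_tac.
Qed.

Lemma lmulC : commutative lmul.
Proof.
move=> x y; have [a [s [hs ->]]] := locP x; have [b [t [ht ->]]] := locP y.
by rewrite !lmulE; loc_tac.
Qed.

Lemma lmul1 : left_id l1 lmul.
Proof. by move=> x; have [a [s [hs ->]]] := locP x; rewrite lmulE; loc_tac. Qed.

Lemma lmulD : left_distributive lmul ladd.
Proof.
move=> x y z; have [a [s [hs ->]]] := locP x; have [b [t [ht ->]]] := locP y.
by have [c [r [hr ->]]] := locP z; rewrite !(laddE, lmulE); loc_tac.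
Qed.

HB.instance Definition _ := GRing.isZmodule.Build loc laddA laddC ladd0 laddN.
HB.instance Definition _ :=
  GRing.Zmodule_isComPzRing.Build loc lmulA lmulC lmul1 lmulD.

Definition toloc a : loc := mkf a S1.

Lemma toloc_zmod : zmod_morphism toloc.
Proof.
move=> a b; rewrite /toloc -[mkf a S1 - _]/(ladd _ (lopp _)) loppE laddE; loc_tac.
Qed.

Lemma toloc_monoid : monoid_morphism toloc.
Proof. by split=> // a b; rewrite /toloc [RHS]lmulE; loc_tac. Qed.

HB.instance Definition _ := GRing.isZmodMorphism.Build k loc toloc toloc_zmod.
HB.instance Definition _ := GRing.isMonoidMorphism.Build k loc toloc toloc_monoid.

(** The later arguments use the ring of fractions only through these three properties. *)
Theorem localization : exists (A : comPzRingType) (f : {rmorphism k -> A}),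
  [/\ forall s, S s -> exists d, d * f s = 1,
      forall a, exists s x, S s /\ f s * a = f x &
      forall x, f x = 0 -> exists2 s, S s & s * x = 0].
Proof.
exists loc, toloc; split=> [s hs|x|x].
- by exists (mkf 1 hs); rewrite [LHS]lmulE; loc_tac.
- have [a [s [hs ->]]] := locP x; exists s, a; split=> //.
  by rewrite [LHS]lmulE; loc_tac.
- by move=> /mkf_eq[u hu]; rewrite mul0r !mulr1 mulr0; exists u.
Qed.

End Localization.

Lemma prod_extend (A : comPzRingType) a b c (P : pred nat) (F : nat -> A) :
  (a <= b)%N -> (b <= c)%N -> (forall j, (b <= j)%N -> F j = 1) ->
  \prod_(a <= j < c | P j) F j = \prod_(a <= j < b | P j) F j.
Proof.
move=> ab bc h; rewrite (@big_cat_nat _ _ _ b) //= [X in _ * X]big_nat_cond.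
by rewrite [X in _ * X]big1 ?mulr1 // => j /andP[/andP[bj _] _]; apply: h.
Qed.

(** * Coordinates over the local ring *)

Section WeightedMap.
Variables (A : comPzRingType) (h m nn : nat) (G : 'I_h -> 'I_m -> 'I_h -> 'I_nn -> A).

(** A block of h consecutive degrees is stored as a matrix: rows are the degrees in the block,
    columns the relations (source) or the module generators (target). *)
Definition wmap (rho : 'M[A]_(h, m)) : 'M[A]_(h, nn) :=
  \matrix_(i, j) \sum_l \sum_a rho a l * G a l i j.

Lemma wmap_linear : linear wmap.
Proof.
move=> c x y; apply/matrixP => i j; rewrite !mxE mulr_sumr -big_split /=.
apply: eq_bigr => l _; rewrite mulr_sumr -big_split /=.
by apply: eq_bigr => a _; rewrite !mxE mulrDl mulrA.
Qed.

HB.instance Definition _ := GRing.isLinear.Build A _ _ _ wmap wmap_linear.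

End WeightedMap.

Section Local.
Variables (A : comPzRingType) (pi : nat -> A) (S : pred nat).
Hypotheses (hunitS : forall j c, S j -> exists d, d * (1 - c * pi j) = 1)
  (hunit : forall j, ~~ S j -> exists d, d * pi j = 1)
  (hinf : forall N, exists j, (N <= j)%N && S j)
  (hchain : forall i j, (2 <= i)%N -> (2 <= j)%N -> S i -> S j ->
    (i %| j)%N \/ (j %| i)%N).

(* Replacing x^[q] by th q *: x^[q] replaces the structure constant Cab by CS,
   which only involves the indices in S. *)
Definition th q := \prod_(2 <= j < q.+1 | ~~ S j) pi j ^+ (q %/ j).

Definition CS a b := \prod_(2 <= j < (a + b).+1 | S j) pi j ^+ eps j a b.

Arguments th q%_N.
Arguments CS (a b)%_N.

Lemma eps_small j a b : (a + b < j)%N -> eps j a b = 0%N.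
Proof. by move=> h; rewrite /eps divn_small. Qed.

Lemma CSE B a b : (1 <= a + b)%N -> (a + b < B)%N ->
  CS a b = \prod_(2 <= j < B | S j) pi j ^+ eps j a b.
Proof. by move=> h h'; rewrite (@prod_extend _ 2 (a + b).+1) // => j ?; rewrite eps_small. Qed.

Lemma CS00 : CS 0 0 = 1. Proof. by rewrite /CS big_geq. Qed.

Lemma thE B q : (1 <= q)%N -> (q < B)%N ->
  th q = \prod_(2 <= j < B | ~~ S j) pi j ^+ (q %/ j).
Proof.
by move=> h h'; rewrite (@prod_extend _ 2 q.+1) // => j hj; rewrite divn_small.
Qed.

Lemma th0 : th 0 = 1. Proof. by rewrite /th big_geq. Qed.

Lemma Cab0 a : Cab pi a 0 = 1.
Proof. by rewrite /Cab big1 // => j _; rewrite /eps addn0 div0n subn0 subnn. Qed.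

(** For j outside S the exponent [eps j a b] is the defect of additivity of q %/ j, so [th] absorbs
    the corresponding factors. *)
Lemma Cab_th a b : Cab pi a b * (th a * th b) = CS a b * th (a + b).
Proof.
have E B c : (c < B)%N -> (2 <= B)%N ->
    th c = \prod_(2 <= j < B | ~~ S j) pi j ^+ (c %/ j).
  case: c => [|c] h h2; last exact: thE.
  by rewrite th0 big1 // => j _; rewrite div0n.
case: (posnP (a + b)) => [|ab].
  by case: a b => // -[|//] _; rewrite addn0 !th0 Cab0 CS00 !mulr1.
rewrite !(E (a + b).+1) ?ltnS ?leq_addr ?leq_addl //.
rewrite /Cab (bigID S) /= -/(CS a b) -!mulrA -!big_split /=; congr (_ * _).
apply: eq_bigr => j _; rewrite -!exprD; congr (_ ^+ _).
case: (posnP j) => [->|j0]; rewrite /eps ?divn0 // divnD //.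
by move: (nat_of_bool _) (a %/ j)%N (b %/ j)%N => c u v; lia.
Qed.

Lemma th_unit q : exists d, d * th q = 1.
Proof.
rewrite /th; apply: (big_ind (fun x => exists d, d * x = 1)).
- by exists 1; rewrite mulr1.
- by move=> x y [d e] [d' e']; exists (d * d'); rewrite mulrACA e e' mulr1.
- move=> j /hunit[d e]; exists (d ^+ (q %/ j)).
  by rewrite -exprMn e expr1n.
Qed.

(** * Blocks of length h and the levels above h *)

Section Levels.
Variable h : nat.
Hypotheses (h2 : (2 <= h)%N) (Sh : S h).
Let h0 : (0 < h)%N := ltnW h2.

Lemma next_ex N : exists j, (N < j)%N && S j.
Proof. exact: hinf. Qed.

Definition next N := ex_minn (next_ex N).

Lemma nextP N : [/\ (N < next N)%N, S (next N) &
  forall j, (N < j)%N -> S j -> (next N <= j)%N].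
Proof.
rewrite /next; case: ex_minnP => j /andP[Nj Sj] hmin.
by split=> // i Ni Si; apply: hmin; rewrite Ni.
Qed.

Definition lev i := iter i next h.

Lemma levS i : S (lev i).
Proof. by case: i => //= i; case: (nextP (lev i)). Qed.

Lemma lev_lt i : (lev i < lev i.+1)%N.
Proof. by case: (nextP (lev i)). Qed.

Lemma lev_ge i : (h <= lev i)%N.
Proof. by elim: i => // i /leq_trans; apply; apply: ltnW; exact: lev_lt. Qed.

Lemma S_dvd i j : (2 <= i)%N -> (i <= j)%N -> S i -> S j -> (i %| j)%N.
Proof.
move=> i2 ij Si Sj; have j2 := leq_trans i2 ij.
have [//|d] := hchain i2 j2 Si Sj.
suff -> : i = j by exact: dvdnn.
by apply/eqP; rewrite eqn_leq ij dvdn_leq // ltnW.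
Qed.

Lemma lev_dvd i : (lev i %| lev i.+1)%N.
Proof.
apply: S_dvd; rewrite ?levS // ?(ltnW (lev_lt i)) //.
exact: leq_trans h2 (lev_ge i).
Qed.

Lemma h_lev i : (h %| lev i)%N.
Proof. by elim: i => [|i /dvdn_trans]; [exact: dvdnn|apply; exact: lev_dvd]. Qed.

Definition rlev i := (lev i %/ h)%N.

Lemma levE i : (h * rlev i)%N = lev i.
Proof. by rewrite mulnC divnK // h_lev. Qed.

Lemma rlev0 : rlev 0 = 1%N. Proof. by rewrite /rlev /= divnn h0. Qed.

Lemma rlev_dvd i : (rlev i %| rlev i.+1)%N.
Proof. by rewrite -(@dvdn_pmul2l h) // !levE lev_dvd. Qed.

Lemma rlev_lt i : (rlev i < rlev i.+1)%N.
Proof. by rewrite -(@ltn_pmul2l h) // !levE lev_lt. Qed.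

(** The index starts at [lev 1]: the factor at [lev 0], which is h, already occurs in the constants
    [CS a b] with a, b < h that enter [al_mx] and [be_mx]. *)
Definition plev i := pi (lev i.+1).

Lemma prod_lev (F : nat -> A) I :
  \prod_(h.+1 <= j < (lev I).+1 | S j) F j = \prod_(0 <= i < I) F (lev i.+1).
Proof.
elim: I => [|I IH]; first by rewrite !big_geq.
rewrite (@big_cat_nat _ _ _ (lev I).+1) /=; last first.
- by rewrite ltnS ltnW // lev_lt.
- by rewrite ltnS lev_ge.
rewrite IH [RHS]big_nat_recr //=; congr (_ * _).
rewrite big_mkcond big_nat_recr ?lev_lt //= (levS I.+1 : S (next (lev I))).
rewrite big_nat_cond big1 ?mul1r // => j /andP[/andP[j1 j2] _]; case: ifP => // Sj.
have [_ _ hmin] := nextP (lev I); have := hmin j j1 Sj.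
by rewrite leqNgt j2.
Qed.

Local Notation LAM := (nuI plev rlev 0).

(** An index j <= h of S divides h and does not see h q. An index j > h of S is a multiple of h: it
    only sees whether a + b carries into the next block, and then contributes exactly when it
    divides h (q + 1). *)
Lemma CS_block q a b : (a < h)%N -> (b < h)%N ->
  CS (h * q + a) b = CS a b * (if (h <= a + b)%N then LAM q.+1 else 1).
Proof.
move=> ah bh.
have [ab0|ab] := posnP (a + b).
  rewrite ifF; last by lia.
  have -> : b = 0%N by lia.
  by rewrite mulr1 /CS !big1 // => j _; rewrite /eps addn0 div0n subn0 subnn.
have nq := n_gt rlev0 rlev_lt q.+1.
have Bq : (h * q + a + b < (lev q.+1).+1)%N.
  have : (h * (q + 2) <= lev q.+1)%N by rewrite -levE leq_mul2l addn2 nq orbT.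
  rewrite mulnDr. lia.
rewrite !(@CSE (lev q.+1).+1) //; [|by lia..].
rewrite !(@big_cat_nat _ _ _ h.+1 2 (lev q.+1).+1) ?ltnS ?lev_ge //; try lia.
rewrite [X in _ = _ * X * _]big_nat_cond [X in _ = _ * X * _]big1; last first.
  move=> j /andP[/andP[hj _] Sj].
  have /dvdnP[e ej] := @S_dvd h j h2 (ltnW hj) Sh Sj.
  have e2 : (2 * h <= j)%N.
    by rewrite ej leq_pmul2r //; move: hj; rewrite ej -[X in (X < _)%N]mul1n ltn_pmul2r.
  by rewrite eps_small //; lia.
rewrite mulr1; congr (_ * _).
  rewrite big_nat_cond [RHS]big_nat_cond; apply: eq_bigr => j.
  move=> /andP[/andP[j2 jh] Sj]; congr (_ ^+ _).
  have d : (j %| h * q)%N by apply: dvdn_mulr; apply: S_dvd.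
  by rewrite /eps -addnA !(divnDl _ d); lia.
rewrite prod_lev /nuI /nu add0n.
have E i : eps (lev i.+1) (h * q + a) b = ((h <= a + b) && (rlev i.+1 %| q.+1))%N.
  have hn : (0 < rlev i.+1)%N := n_gt0 rlev0 rlev_lt i.+1.
  rewrite /eps -levE !divnMA ![(h * q)%N]mulnC -addnA !divnMDl //.
  rewrite (divn_small ah) (divn_small bh) addn0 div0n subn0.
  case: leqP => hab /=; last by rewrite (divn_small hab) addn0 subnn.
  have -> : ((a + b) %/ h = 1)%N.
    by rewrite -[(a + b)%N](subnK hab) addnC divnDl ?divnn ?h0 ?divn_small //; lia.
  by rewrite addn1 divnS // addnK.
case: leqP => hab.
  rewrite [RHS]big_mkcond; apply: eq_bigr => i _; rewrite E hab /=.
  by case: ifP; rewrite ?expr1 ?expr0.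
by rewrite big1 // => i _; rewrite E leqNgt hab.
Qed.

(** No carry occurs: an index j <= lev s of S divides lev s, and a larger one is at least 2 lev s >
    lev s + x. In the rescaled basis, x^[lev s] therefore acts on low degrees as a plain shift. *)
Lemma CS_lev s x : (x < lev s)%N -> CS (lev s) x = 1.
Proof.
move=> hx; rewrite /CS big_nat_cond big1 // => j /andP[/andP[j2 _] Sj].
suff -> : eps j (lev s) x = 0%N by [].
case: (leqP j (lev s)) => hj.
  by rewrite /eps divnDl ?S_dvd ?levS // addKn subnn.
have /dvdnP[e ej] : (lev s %| j)%N.
  by apply: S_dvd; rewrite ?levS // ?(leq_trans h2 (lev_ge s)) // ltnW.
have e2 : (2 * lev s <= j)%N.
  move: hj; rewrite ej leq_pmul2r ?(leq_trans h0 (lev_ge s)) //.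
  by rewrite -[X in (X < _)%N]mul1n ltn_pmul2r // (leq_trans h0 (lev_ge s)).
by apply: eps_small; lia.
Qed.

(** The relations have degrees below h, so only the current block and the preceding one contribute
    to a product. *)
Lemma block_sum (F : nat -> A) q i : (i < h)%N ->
  (forall a, (a + h <= h * q + i)%N -> F a = 0) ->
  \sum_(a < (h * q + i).+1) F a =
  \sum_(a < h) (if (a <= i)%N then F (h * q + a)%N else 0) +
  (if q is q'.+1 then \sum_(a < h) (if (i < a)%N then F (h * q' + a)%N else 0) else 0).
Proof.
move=> ih hF; rewrite -(big_mkord xpredT F) (@big_cat_nat _ _ _ (h * q)) /=; last first.
- by rewrite ltnW // ltnS leq_addr.
- by [].
rewrite addrC; congr (_ + _).
  rewrite -addnS -{1}[(h * q)%N]add0n big_addn addKn.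
  rewrite -(big_mkord xpredT (fun a => if (a <= i)%N then F (h * q + a)%N else 0)).
  rewrite [RHS](@big_cat_nat _ _ _ i.+1) //= [X in _ = _ + X]big_nat_cond.
  rewrite [X in _ = _ + X]big1; last by move=> a /andP[/andP[ha _] _]; rewrite leqNgt ha.
  rewrite addr0 big_nat_cond [RHS]big_nat_cond; apply: eq_bigr => a /andP[/andP[_ ha] _].
  by rewrite -ltnS ha addnC.
case: q hF => [|q] hF; first by rewrite muln0 big_geq.
rewrite (@big_cat_nat _ _ _ (h * q)) //=; last by rewrite leq_pmul2l.
rewrite big_nat_cond big1 ?add0r; last first.
  by move=> a /andP[/andP[_ ha] _]; apply: hF; rewrite mulnS; lia.
rewrite -{1}[(h * q)%N]add0n big_addn mulnS addnK.
rewrite big_mkord; apply: eq_bigr => a _; rewrite addnC; case: ltnP => // ai.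
by apply: hF; rewrite mulnS; lia.
Qed.

Variables (nn m : nat) (r : 'I_m -> 'I_nn -> nat -> A).
Hypothesis hr : forall l j b, (h <= b)%N -> r l j b = 0.
Variable thi : nat -> A.
Hypothesis thiK : forall q, thi q * th q = 1.

(** The submodule of a free module over the algebra generated by the relations r, in terms of
    coefficient functions. *)
Definition rel_image (f : 'I_nn -> nat -> A) := exists2 H : 'I_m -> nat -> A,
  exists B, forall l a, (B <= a)%N -> H l a = 0 &
  forall j i, f j i = \sum_l \sum_(a < i.+1) H l a * r l j (i - a)%N * Cnm pi i (i - a).

(** The rescaled structure constants, split by whether the product of degree a with a term of the
    relation stays in its block ([carry0_coef]) or carries into the next one ([carry1_coef]). *)
Definition carry0_coef (a : 'I_h) l (i : 'I_h) j : A :=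
  if (a <= i)%N then thi (i - a) * r l j (i - a)%N * CS a (i - a) else 0.
Definition carry1_coef (a : 'I_h) l (i : 'I_h) j : A :=
  if (i < a)%N then thi (h + i - a) * r l j (h + i - a)%N * CS a (h + i - a) else 0.
Definition al_mx : {linear 'M[A]_(h, m) -> 'M[A]_(h, nn)} := wmap carry0_coef.
Definition be_mx : {linear 'M[A]_(h, m) -> 'M[A]_(h, nn)} := wmap carry1_coef.

Lemma Cab_thi a b : thi (a + b) * Cab pi a b = thi a * thi b * CS a b.
Proof.
have := congr1 (fun x => thi (a + b) * (thi a * thi b) * x) (Cab_th a b).
have -> : thi (a + b) * (thi a * thi b) * (Cab pi a b * (th a * th b))
  = thi (a + b) * Cab pi a b * ((thi a * th a) * (thi b * th b)) by ring.
have -> : thi (a + b) * (thi a * thi b) * (CS a b * th (a + b))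
  = thi a * thi b * CS a b * (thi (a + b) * th (a + b)) by ring.
by rewrite !thiK !mulr1.
Qed.

Lemma bd_formula (H : 'I_m -> nat -> A) q (i : 'I_h) j :
  bd al_mx be_mx LAM (fun q => \matrix_(a, l) (thi (h * q + a) * H l (h * q + a)%N)) q i j
  = thi (h * q + i) * \sum_l \sum_(a < (h * q + i).+1)
      H l a * r l j (h * q + i - a)%N * Cnm pi (h * q + i) (h * q + i - a).
Proof.
pose F l a := (thi a * H l a) *
  (thi (h * q + i - a) * r l j (h * q + i - a)%N * CS a (h * q + i - a)).
transitivity (\sum_l \sum_(a < (h * q + i).+1) F l a); last first.
  rewrite mulr_sumr; apply: eq_bigr => l _; rewrite mulr_sumr; apply: eq_bigr => a _.
  have ha : (a <= h * q + i)%N by rewrite -ltnS.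
  have := Cab_thi a (h * q + i - a); rewrite subnKC // => e.
  rewrite /Cnm subKn // /F.
  transitivity (H l a * r l j (h * q + i - a)%N * (thi a * thi (h * q + i - a) * CS a (h * q + i - a))).
    ring.
  rewrite -e; ring.
have F0 l a : (a + h <= h * q + i)%N -> F l a = 0.
  by move=> ha; rewrite /F hr ?mulr0 ?mul0r ?mulr0 //; lia.
under eq_bigr => l _ do rewrite (block_sum (ltn_ord i) (F0 l)).
rewrite big_split /bd /= mxE; congr (_ + _).
  rewrite mxE; apply: eq_bigr => l _; apply: eq_bigr => a _; rewrite mxE /carry0_coef /F.
  case: leqP => ai; last by rewrite mulr0.
  rewrite subnDl CS_block //; last by rewrite (leq_ltn_trans (leq_subr _ _)).
  by rewrite subnKC // leqNgt ltn_ord mulr1.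
case: q @F F0 => [|q] F F0; first by rewrite big1 // mxE.
rewrite !mxE mulr_sumr; apply: eq_bigr => l _; rewrite mulr_sumr.
apply: eq_bigr => a _; rewrite mxE /carry1_coef /F.
case: ltnP => ai; last by rewrite !mulr0.
have -> : (h * q.+1 + i - (h * q + a) = h + i - a)%N by rewrite mulnS; lia.
have la := ltn_ord a.
rewrite CS_block //; last by lia.
rewrite subnKC; last by lia.
rewrite leq_addr; ring.
Qed.

Lemma rel_image_im f : rel_image f <->
  im al_mx be_mx LAM (fun q => \matrix_(i, j) (thi (h * q + i) * f j (h * q + i)%N)).
Proof.
split=> [[H [B hB] e]|[rho [B hB] e]].
  exists (fun q => \matrix_(a, l) (thi (h * q + a) * H l (h * q + a)%N)).
    exists B => q hq; apply/matrixP => a l; rewrite !mxE hB ?mulr0 //.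
    by apply: leq_trans hq _; nia.
  apply/funext => q; apply/matrixP => i j; rewrite bd_formula mxE.
  by rewrite e.
pose H l x := th x * rho (x %/ h)%N (Ordinal (ltn_pmod x h0)) l.
have hrho : rho = fun q => \matrix_(a, l) (thi (h * q + a) * H l (h * q + a)%N).
  apply/funext => q; apply/matrixP => a l; rewrite mxE /H mulrA thiK mul1r.
  rewrite mulnC divnMDl // divn_small // addn0; congr (rho q _ l).
  by apply: val_inj; rewrite /= modnMDl modn_small.
exists H.
  exists (B * h)%N => l a ha; rewrite /H hB ?mxE ?mulr0 //.
  by rewrite leq_divRL.
move=> j x; have xE := divn_eq x h; rewrite mulnC in xE.
have := congr1 (fun g : nat -> 'M[A]_(h, nn) => g (x %/ h)%N (Ordinal (ltn_pmod x h0)) j) e.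
rewrite {}hrho bd_formula mxE /= -xE => /(congr1 (fun y => th x * y)).
by rewrite !mulrA ![th x * _]mulrC thiK !mul1r.
Qed.

Theorem rel_image_torsion_at (f : 'I_nn -> nat -> A) :
  noetherian A -> (exists d, forall j i, (d <= i)%N -> f j i = 0) ->
  (exists N0, forall x, (N0 <= x)%N ->
     rel_image (fun j i => if (i < x)%N then 0 else f j (i - x)%N * Cnm pi i (i - x))) ->
  rel_image f.
Proof.
move=> noethA [d hd] [N0 hN0]; apply/rel_image_im.
apply: (@pencil_torsion _ plev rlev rlev0 rlev_dvd rlev_lt).
- exact: acc_mx.
- by move=> i c; apply: hunitS; exact: levS.
- exists d => q hq; apply/matrixP => i j; rewrite !mxE hd ?mulr0 //.
  by apply: leq_trans hq _; nia.
exists (maxn N0 d) => s; rewrite geq_max => /andP[sN sd].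
(* Thus lev s >= N0, where the torsion hypothesis applies, and lev s >= d, so that [CS_lev] covers
   the whole support of f. *)
have sl : (s <= lev s)%N.
  by rewrite -levE; have := n_gt rlev0 rlev_lt s; nia.
have /rel_image_im := hN0 (lev s) (leq_trans sN sl).
(* The factor [th (lev s)] rescales x^[lev s] itself; after it, the product is the shift by rlev s
   blocks. *)
move=> /(imZ (th (lev s))); congr (im al_mx be_mx _ _).
apply/funext => q; rewrite scalrfctE /sh; apply/matrixP => i j; rewrite !mxE.
rewrite -levE; case: (ltnP q (rlev s)) => hq.
  rewrite mxE ifT ?mulr0 //.
  have : (h * q.+1 <= h * rlev s)%N by rewrite leq_mul2l hq orbT.
  by rewrite mulnS; have := ltn_ord i; lia.
have hq' : (h * rlev s <= h * q)%N by rewrite leq_mul2l hq orbT.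
rewrite ifF; last by lia.
rewrite mxE.
have -> : (h * q + i - h * rlev s = h * (q - rlev s) + i)%N by rewrite mulnBr; lia.
set x := (h * (q - rlev s) + i)%N.
have xE : (h * q + i = h * rlev s + x)%N by rewrite /x mulnBr; lia.
case: (leqP d x) => dx; first by rewrite hd // !(mul0r, mulr0).
rewrite xE /Cnm addnK.
transitivity (th (h * rlev s) * f j x * (thi (h * rlev s + x) * Cab pi (h * rlev s) x)); first ring.
rewrite Cab_thi levE CS_lev; last exact: leq_trans dx (leq_trans sd sl).
transitivity ((thi (lev s) * th (lev s)) * (thi x * f j x)); first ring.
by rewrite thiK mul1r.
Qed.

End Levels.

Theorem rel_image_torsion nn m (r : 'I_m -> 'I_nn -> nat -> A) (f : 'I_nn -> nat -> A) :
  noetherian A -> (exists B, forall l j b, (B <= b)%N -> r l j b = 0) ->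
  (exists d, forall j i, (d <= i)%N -> f j i = 0) ->
  (exists N0, forall x, (N0 <= x)%N ->
     rel_image r (fun j i => if (i < x)%N then 0 else f j (i - x)%N * Cnm pi i (i - x))) ->
  rel_image r f.
Proof.
move=> noethA [B hB] hf htors; have [h /andP[hge Sh]] := hinf (maxn 2 B).
have [thi hthi] := boolp.choice th_unit.
apply: (@rel_image_torsion_at h _ Sh nn m r _ thi hthi) => //.
- by apply: leq_trans hge; exact: leq_maxl.
- by move=> l j b hb; apply: hB; apply: leq_trans hb; apply: leq_trans hge; exact: leq_maxr.
Qed.

End Local.

(** * Finitely presented modules *)

Lemma sum_trunc (V : nmodType) (F : nat -> V) B C : (C <= B)%N ->
  (forall a, (C <= a)%N -> F a = 0) -> \sum_(a < B) F a = \sum_(a < C) F a.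
Proof.
move=> CB h; rewrite -!(big_mkord xpredT) (@big_cat_nat _ _ _ C) //= [X in _ + X]big_nat_cond.
by rewrite [X in _ + X]big1 ?addr0 // => a /andP[/andP[Ca _] _]; apply: h.
Qed.

Lemma sum_triangle (V : nmodType) (F : nat -> nat -> V) B :
  \sum_(i < B) \sum_(a < i.+1) F a (i - a)%N = \sum_(a < B) \sum_(b < B - a) F a b.
Proof.
elim: B => [|B IH]; first by rewrite !big_ord0.
rewrite [LHS]big_ord_recr /= IH [RHS]big_ord_recr /= subSnn big_ord1.
rewrite [X in _ + X]big_ord_recr /= subnn addrA -big_split /=; congr (_ + _).
by apply: eq_bigr => a _; rewrite subSn ?big_ord_recr //= ltnW.
Qed.

Section Bridge.
Variables (k : comPzRingType) (pi : nat -> k).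

Lemma nth_Dmul (h p : seq k) i :
  (Dmul pi h p)`_i = \sum_(a < i.+1) h`_a * p`_(i - a) * Cnm pi i (i - a).
Proof.
rewrite /Dmul; have [ih|ih] := ltnP i (size h + size p); first by rewrite nth_mkseq.
rewrite nth_default ?size_mkseq // big1 // => a _.
have [ha|ha] := leqP (size h) a; first by rewrite (nth_default _ ha) !mul0r.
have hp : (size p <= i - a)%N by rewrite leq_subRL; lia.
by rewrite (nth_default _ hp) mulr0 mul0r.
Qed.

Variables (M : lmodType k) (act : nat -> M -> M).
Hypothesis hM : Dmodule pi act.

Lemma actD i x y : act i (x + y) = act i x + act i y.
Proof. by have [h _ _] := hM; rewrite -[x]scale1r h !scale1r. Qed.

Lemma act0 i : act i 0 = 0.
Proof. by apply: (addIr (act i 0)); rewrite -actD !add0r. Qed.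

Lemma actZ i a x : act i (a *: x) = a *: act i x.
Proof. by have [h _ _] := hM; rewrite -[a *: x]addr0 h act0 addr0. Qed.

Lemma act_sum i (T : Type) (s : seq T) (P : pred T) (F : T -> M) :
  act i (\sum_(t <- s | P t) F t) = \sum_(t <- s | P t) act i (F t).
Proof. by apply: (big_morph (act i)); [exact: actD|exact: act0]. Qed.

Lemma DactE B (d : seq k) x : (size d <= B)%N ->
  Dact act d x = \sum_(i < B) d`_i *: act i x.
Proof.
move=> h; rewrite /Dact (big_ord_widen_cond _ xpredT (fun i => d`_i *: act i x) h).
rewrite big_mkcond; apply: eq_bigr => i _; case: ltnP => // hi.
by rewrite nth_default // scale0r.
Qed.

Lemma Dact_mul h p x : Dact act (Dmul pi h p) x = Dact act h (Dact act p x).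
Proof.
pose B := (size h + size p)%N.
rewrite (@DactE B) ?size_mkseq // {2}/Dact.
transitivity (\sum_(a < size h) \sum_(b < size p)
   (h`_a * p`_b * Cnm pi (a + b) b) *: act (a + b)%N x); last first.
  apply: eq_bigr => a _; rewrite /Dact act_sum scaler_sumr; apply: eq_bigr => b _.
  by have [_ _ e] := hM; rewrite actZ e !scalerA -!mulrA.
pose F a b := (h`_a * p`_b * Cnm pi (a + b) b) *: act (a + b)%N x.
have F1 a b : (size h <= a)%N -> F a b = 0.
  by move=> e; rewrite /F (nth_default _ e) !mul0r scale0r.
have F2 a b : (size p <= b)%N -> F a b = 0.
  by move=> e; rewrite /F (nth_default _ e) mulr0 mul0r scale0r.
transitivity (\sum_(i < B) \sum_(a < i.+1) F a (i - a)%N).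
  apply: eq_bigr => i _; rewrite nth_Dmul scaler_suml; apply: eq_bigr => a _.
  by rewrite /F subnKC // -ltnS.
rewrite sum_triangle (@sum_trunc _ (fun a => \sum_(b < B - a) F a b) _ (size h)) ?leq_addr //; last first.
  by move=> a ha; rewrite big1 // => b _; exact: F1.
apply: eq_bigr => a _; rewrite (@sum_trunc _ (F a) _ (size p)) //.
  by rewrite /B; have := ltn_ord a; lia.
by move=> b; exact: F2.
Qed.

Lemma DactZD a (d e : seq k) u x : (forall i, u`_i = a * d`_i + e`_i) ->
  Dact act u x = a *: Dact act d x + Dact act e x.
Proof.
move=> h; pose B := maxn (size u) (maxn (size d) (size e)).
rewrite !(@DactE B) ?leq_max ?leqnn ?orbT // scaler_sumr -big_split /=.
by apply: eq_bigr => i _; rewrite h scalerDl scalerA.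
Qed.

Lemma Dact_eq (d e : seq k) x : (forall i, d`_i = e`_i) -> Dact act d x = Dact act e x.
Proof.
move=> h; pose B := maxn (size d) (size e).
rewrite !(@DactE B) ?leq_max ?leqnn ?orbT //.
by apply: eq_bigr => i _; rewrite h.
Qed.

Lemma Dact0 (d : seq k) x : (forall i, d`_i = 0) -> Dact act d x = 0.
Proof. by move=> h; rewrite /Dact big1 // => i _; rewrite h scale0r. Qed.

Lemma Dact_sum m (F : 'I_m -> seq k) (d : seq k) x :
  (forall i, d`_i = \sum_l (F l)`_i) -> Dact act d x = \sum_l Dact act (F l) x.
Proof.
elim: m F d => [|m IH] F d h.
  by rewrite big_ord0; apply: Dact0 => i; rewrite h big_ord0.
pose e := mkseq (fun i => \sum_l (F (lift ord0 l))`_i) (\max_l size (F l)).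
have he i : e`_i = \sum_l (F (lift ord0 l))`_i.
  rewrite /e; have [hi|hi] := ltnP i (\max_l size (F l)); first by rewrite nth_mkseq.
  rewrite nth_default ?size_mkseq // big1 // => l _; rewrite nth_default //.
  by apply: leq_trans hi; apply: (leq_bigmax (F := fun l => size (F l))).
rewrite big_ord_recl -(IH _ _ he) -[X in X + _]scale1r; apply: DactZD => i.
by rewrite h big_ord_recl mul1r he.
Qed.

(** The product x^[n] d, written in the shape of the torsion hypothesis of [rel_image_torsion]. *)
Definition mulx n (d : seq k) : seq k :=
  mkseq (fun i => if (i < n)%N then 0 else d`_(i - n) * Cnm pi i (i - n)) (n + size d).

Lemma nth_mulx n d i :
  (mulx n d)`_i = if (i < n)%N then 0 else d`_(i - n) * Cnm pi i (i - n).
Proof.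
rewrite /mulx; have [h|h] := ltnP i (n + size d); first by rewrite nth_mkseq.
rewrite nth_default ?size_mkseq //; case: ltnP => // ni.
by rewrite nth_default ?mul0r // leq_subRL.
Qed.

Lemma Dact_mulx n d x : Dact act (mulx n d) x = act n (Dact act d x).
Proof.
pose e := rcons (nseq n 0) (1 : k).
(* e represents x^[n], which reduces the claim to [Dact_mul]. *)
have en i : e`_i = (i == n)%:R.
  rewrite nth_rcons size_nseq nth_nseq; case: (ltngtP i n) => //.
rewrite (Dact_eq x (e := Dmul pi e d)); last first.
  move=> i; rewrite nth_mulx nth_Dmul; case: ltnP => ni.
    rewrite big1 // => a _; rewrite en (_ : _ == _ = false) ?mul0r //.
    by apply/eqP; have := ltn_ord a; lia.
  have ni' : (n < i.+1)%N by [].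
  rewrite (bigD1 (Ordinal ni')) //= en eqxx mul1r big1 ?addr0 // => a ne.
  by rewrite en (_ : _ == _ = false) ?mul0r //; apply: contraNF ne => /eqP e'; apply/eqP/val_inj.
rewrite Dact_mul (@DactE n.+1 e) ?size_rcons ?size_nseq // (bigD1 ord_max) //=.
rewrite en eqxx scale1r big1 ?addr0 // => a ne.
rewrite en (_ : _ == _ = false) ?scale0r //.
by apply: contraNF ne => /eqP e'; apply/eqP/val_inj.
Qed.

Variables (nn : nat) (g : 'I_nn -> M).

Lemma Dev_mulx n f : Dev act g (fun j => mulx n (f j)) = act n (Dev act g f).
Proof. by rewrite /Dev act_sum; apply: eq_bigr => j _; rewrite Dact_mulx. Qed.

Lemma Dev_rel m (r : 'I_m -> 'I_nn -> seq k) (h : 'I_m -> seq k) f :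
  (forall l, Dev act g (r l) = 0) ->
  (forall j i, (f j)`_i = \sum_l (Dmul pi (h l) (r l j))`_i) ->
  Dev act g f = 0.
Proof.
move=> hr hf; rewrite /Dev.
transitivity (\sum_j \sum_l Dact act (h l) (Dact act (r l j) (g j))).
  apply: eq_bigr => j _; rewrite (Dact_sum (g j) (hf j)).
  by apply: eq_bigr => l _; rewrite Dact_mul.
rewrite exchange_big /= big1 // => l _.
have D0 (d : seq k) : Dact act d 0 = 0.
  by rewrite /Dact big1 // => i _; rewrite act0 scaler0.
have DD (d : seq k) (x y : M) : Dact act d (x + y) = Dact act d x + Dact act d y.
  by rewrite /Dact -big_split /=; apply: eq_bigr => i _; rewrite actD scalerDr.
by rewrite -(big_morph _ (DD (h l)) (D0 (h l))) -/(Dev act g (r l)) hr.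
Qed.

End Bridge.

Lemma nth_scale (k : comPzRingType) (c : k) (d : seq k) i :
  [seq c * y | y <- d]`_i = c * d`_i.
Proof.
have [h|h] := ltnP i (size d); first by rewrite (nth_map 0).
by rewrite !nth_default ?size_map // mulr0.
Qed.

Lemma rmorph_Cnm (k A : comPzRingType) (phi : {rmorphism k -> A}) (pi : nat -> k) n m :
  phi (Cnm pi n m) = Cnm (fun j => phi (pi j)) n m.
Proof. by rewrite /Cnm /Cab rmorph_prod; apply: eq_bigr => j _; rewrite rmorphXn. Qed.

(** * Clearing denominators in a ring of fractions *)

Section Denominators.
Variables (k A : comPzRingType) (phi : {rmorphism k -> A}) (S : pred k).
Hypotheses (S1 : S 1) (SM : forall x y, S x -> S y -> S (x * y)).
Hypothesis phi_unit : forall s, S s -> exists d, d * phi s = 1.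
Hypothesis phi_frac : forall a, exists s x, S s /\ phi s * a = phi x.
Hypothesis phi_ker : forall x, phi x = 0 -> exists2 s, S s & s * x = 0.

Lemma noetherian_loc : noetherian k -> noetherian A.
Proof.
move=> hk J hJ; have [|n [g [hg hspan]]] := hk (fun x => J (phi x)).
  split; first by rewrite rmorph0; exact: ideal0.
    by move=> x y; rewrite rmorphD; exact: idealD.
  by move=> a x; rewrite rmorphM; exact: idealM.
exists n, (phi \o g); split=> // a Ja.
have [s [x [Ss e]]] := phi_frac a; have [d hd] := phi_unit Ss.
have [|c hc] := hspan x; first by rewrite -e; exact: idealM.
exists (fun i => d * phi (c i)); rewrite -[a]mul1r -hd -mulrA e hc rmorph_sum mulr_sumr.
by apply: eq_bigr => i _; rewrite rmorphM mulrA.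
Qed.

Lemma S_prod (T : Type) (r : seq T) (P : pred T) (F : T -> k) :
  (forall i, S (F i)) -> S (\prod_(i <- r | P i) F i).
Proof. by move=> h; apply: (big_ind (fun x => S x)). Qed.

Lemma common_denominator (T : finType) (u : T -> A) :
  exists2 s, S s & exists v : T -> k, forall t, phi s * u t = phi (v t).
Proof.
have /boolp.choice[s /boolp.choice[v h]] := fun t => phi_frac (u t).
exists (\prod_t s t); first by apply: S_prod => t; case: (h t).
exists (fun t => (\prod_(t' | t' != t) s t') * v t) => t.
by rewrite [RHS]rmorphM -(h t).2 mulrA -rmorphM (bigD1 t) //= [s t * _]mulrC.
Qed.

Lemma common_annihilator (T : finType) (x : T -> k) :
  (forall t, phi (x t) = 0) -> exists2 s, S s & forall t, s * x t = 0.
Proof.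
move=> h; have /boolp.choice[s hs] : forall t, exists s, S s /\ s * x t = 0.
  by move=> t; have [s] := phi_ker (h t); exists s.
exists (\prod_t s t); first by apply: S_prod => t; case: (hs t).
by move=> t; rewrite (bigD1 t) //= mulrAC (hs t).2 mul0r.
Qed.

End Denominators.

(** * Condition (b) makes finitely presented modules torsion-free *)

Section TorsionFree.
Variables (k : comPzRingType) (pi : nat -> k).

Lemma supp_seq (T : finType) (F : T -> seq k) :
  exists B, forall t i, (B <= i)%N -> (F t)`_i = 0.
Proof.
exists (\max_t size (F t))%N => t i h; rewrite nth_default //.
by apply: leq_trans h; apply: (leq_bigmax (F := fun t => size (F t))).
Qed.

Theorem fin_pres_torsion_free (M : lmodType k) (act : nat -> M -> M) :
  noetherian k -> admissible pi -> condB pi ->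
  Dmodule pi act -> fin_pres pi act -> torsion_free act.
Proof.
move=> noeth adm hB hM [n [g [hsurj [m [r [hr hrel]]]]]] x [N0 hx].
apply: contrapT => x0; have [f ef] := hsurj x.
(* The annihilator of x is a proper ideal because x is nonzero. *)
have [] := @exists_maximal k (fun s => s *: x = 0) noeth.
- split; first by rewrite scale0r.
    by move=> a b ha hb; rewrite scalerDl ha hb addr0.
  by move=> a b hb; rewrite -scalerA hb scaler0.
- by rewrite scale1r.
move=> P [hP annP]; have [PI P1 _] := hP.
pose S : pred k := fun s => ~~ `[< P s >].
have S1 : S 1 by apply/asboolPn.
have SM a b : S a -> S b -> S (a * b).
  by move=> /asboolPn ha /asboolPn hb; apply/asboolPn; exact: maximal_prime.
have [A [phi [hunit hfrac hker]]] := localization S1 SM.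
pose piA j := phi (pi j).
pose rA l j b := phi (r l j)`_b.
have : rel_image piA rA (fun j i => phi (f j)`_i).
  apply: (@rel_image_torsion A piA (fun j => `[< P (pi j) >])).
  - move=> j c /asboolP Pj; have [s [y [Ss e]]] := hfrac c.
    (* With c = y / s, the element 1 - c pi_j is (s - y pi_j) / s, whose numerator is outside P
       because pi_j lies in P and s does not. *)
    have [|d hd] := hunit (s - y * pi j).
      apply/asboolPn => h; move/asboolPn: Ss; apply.
      by rewrite -[s](subrK (y * pi j)); apply: idealD => //; exact: idealM.
    exists (d * phi s); rewrite -mulrA mulrBr mulr1 mulrA e -hd.
    by rewrite rmorphB rmorphM.
  - by move=> j Pj; exact: hunit.
  - move=> N; have [j [Nj Pj]] := hB P hP N; exists j; rewrite Nj /=.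
    exact/asboolP.
  - move=> i j i2 j2 /asboolP Pi /asboolP Pj; apply: adm => // -[a [b e]].
    by apply: P1; rewrite -e; apply: idealD => //; apply: idealM.
  - exact: noetherian_loc hunit hfrac noeth.
  - have [B hB'] := supp_seq (fun t : 'I_m * 'I_n => r t.1 t.2).
    by exists B => l j b hb; rewrite /rA (hB' (l, j)) // rmorph0.
  - have [B hB'] := supp_seq f.
    by exists B => j i hi; rewrite hB' // rmorph0.
  exists N0 => a ha; have := hrel (fun j => mulx pi a (f j)).
  rewrite (Dev_mulx hM) ef hx // => /(_ erefl)[h eh].
  exists (fun l b => phi (h l)`_b).
    have [B hB'] := supp_seq h.
    by exists B => l b hb; rewrite hB' // rmorph0.
  move=> j i; have /(congr1 phi) := eh j i.
  rewrite nth_mulx rmorph_sum (fun_if phi) rmorph0 rmorphM rmorph_Cnm => ->.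
  apply: eq_bigr => l _; rewrite nth_Dmul rmorph_sum.
  by apply: eq_bigr => b _; rewrite !rmorphM rmorph_Cnm.
move=> [H [B hH] eH].
have [s Ss [v hv]] := common_denominator S1 SM hfrac (fun t : 'I_m * 'I_B => H t.1 t.2).
pose h l := mkseq (fun a => if insub a is Some a' then v (l, a') else 0) B.
have hh l a : phi (h l)`_a = phi s * H l a.
  have [aB|aB] := ltnP a B; last first.
    by rewrite nth_default ?size_mkseq // rmorph0 hH // mulr0.
  by rewrite nth_mkseq // insubT -hv.
(* The defect of the relation for s f over k. It dies in the ring of fractions, so each coordinate
   is killed by some element outside P. *)
pose D (t : 'I_n * nat) := s * (f t.1)`_t.2 - \sum_l (Dmul pi (h l) (r l t.1))`_t.2.
have D0 t : phi (D t) = 0.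
  rewrite /D rmorphB rmorphM eH mulr_sumr rmorph_sum; apply/eqP; rewrite subr_eq0.
  apply/eqP; apply: eq_bigr => l _; rewrite nth_Dmul mulr_sumr rmorph_sum.
  by apply: eq_bigr => a _; rewrite !rmorphM rmorph_Cnm hh !mulrA.
(* Only finitely many coordinates of D can be nonzero, so that one u outside P kills them all; then
   u s annihilates x, a contradiction. *)
have [C hC] : exists C, forall j i, (C <= i)%N -> D (j, i) = 0.
  have [C1 h1] := supp_seq f.
  have [C2 h2] := supp_seq (fun t : 'I_m * 'I_n => Dmul pi (h t.1) (r t.1 t.2)).
  exists (maxn C1 C2) => j i; rewrite geq_max => /andP[i1 i2].
  rewrite /D /= h1 // mulr0 big1 ?subr0 // => l _; exact: (h2 (l, j)).
have [u Su hu] := common_annihilator S1 SM hker (fun t : 'I_n * 'I_C => D0 (t.1, val t.2)).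
have uD j i : u * D (j, i) = 0.
  have [iC|iC] := ltnP i C; last by rewrite hC // mulr0.
  exact: (hu (j, Ordinal iC)).
have : Dev act g (fun j => [seq (u * s) * y | y <- f j]) = 0.
  apply: (Dev_rel hM (h := fun l => [seq u * y | y <- h l]) hr) => j i.
  rewrite nth_scale -mulrA; move/eqP: (uD j i); rewrite mulrBr subr_eq0 => /eqP ->.
  rewrite mulr_sumr; apply: eq_bigr => l _; rewrite !nth_Dmul mulr_sumr.
  by apply: eq_bigr => a _; rewrite nth_scale !mulrA.
have -> : Dev act g (fun j => [seq (u * s) * y | y <- f j]) = (u * s) *: x.
  rewrite -ef /Dev scaler_sumr; apply: eq_bigr => j _.
  rewrite (@DactZD _ _ _ (u * s) (f j) [::]) ?[Dact act [::] _]big_ord0 ?addr0 //.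
  by move=> i; rewrite nth_scale nth_nil addr0.
by move=> /annP; apply/asboolPn; exact: SM.
Qed.

End TorsionFree.

(** * The residue module *)

Section QuotientModule.
Local Open Scope quotient_scope.
Variables (k : comPzRingType) (I : k -> Prop).
Hypothesis hI : is_ideal I.

Definition in_ideal : {pred k} := fun x => `[< I x >].

Lemma in_ideal_zmod : zmod_closed in_ideal.
Proof.
split; first by apply/asboolP; exact: ideal0.
by move=> x y /asboolP hx /asboolP hy; apply/asboolP; exact: idealB.
Qed.

HB.instance Definition _ := GRing.isZmodClosed.Build k in_ideal in_ideal_zmod.

Definition quo := Quotient.quot in_ideal.
HB.instance Definition _ := GRing.Zmodule.on quo.
HB.instance Definition _ := Choice.on quo.

Definition toquo (x : k) : quo := \pi_(Quotient.quot in_ideal) x.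

Lemma toquo_eq x y : toquo x = toquo y <-> I (x - y).
Proof.
rewrite /toquo; split=> [/eqP|h].
  by rewrite -Quotient.idealrBE => /asboolP.
by apply/eqP; rewrite -Quotient.idealrBE; apply/asboolP.
Qed.

Lemma toquo_surj (z : quo) : exists x, z = toquo x.
Proof. by exists (repr z); rewrite /toquo reprK. Qed.

Lemma toquoD x y : toquo (x + y) = toquo x + toquo y.
Proof. by rewrite /toquo raddfD. Qed.

Definition qscale (a : k) (z : quo) : quo := toquo (a * repr z).

Lemma qscaleE a x : qscale a (toquo x) = toquo (a * x).
Proof.
apply/toquo_eq; rewrite -mulrBr; apply: idealM => //.
by apply/toquo_eq; rewrite /toquo reprK.
Qed.

Lemma qscaleA a b z : qscale a (qscale b z) = qscale (a * b) z.
Proof. by have [x ->] := toquo_surj z; rewrite !qscaleE mulrA. Qed.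

Lemma qscale1 : left_id 1 qscale.
Proof. by move=> z; have [x ->] := toquo_surj z; rewrite qscaleE mul1r. Qed.

Lemma qscaleDr : right_distributive qscale +%R.
Proof.
move=> a z z'; have [x ->] := toquo_surj z; have [y ->] := toquo_surj z'.
by rewrite -toquoD !qscaleE mulrDr toquoD.
Qed.

Lemma qscaleDl z : {morph qscale^~ z : a b / a + b}.
Proof.
by move=> a b; have [x ->] := toquo_surj z; rewrite !qscaleE mulrDl toquoD.
Qed.

HB.instance Definition _ :=
  GRing.Zmodule_isLmodule.Build k quo qscaleA qscale1 qscaleDr qscaleDl.

Lemma quotient_module : exists (M : lmodType k) (q : k -> M),
  [/\ forall a x, q (a * x) = a *: q x,
      forall x y, q x = q y <-> I (x - y) & forall z, exists x, z = q x].
Proof.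
exists quo, toquo; split; [|exact: toquo_eq|exact: toquo_surj].
by move=> a x; rewrite -qscaleE.
Qed.

End QuotientModule.

(** * The residue field as a finitely presented torsion module *)

Section ResidueModule.
Variables (k : comPzRingType) (pi : nat -> k) (P : k -> Prop) (N0 : nat).
Hypotheses (hP : maximal_ideal P) (hN0 : forall n, (N0 <= n)%N -> ~ P (pi n)).

Let PI : is_ideal P. Proof. by case: hP. Qed.

(** An index j < N0 divides N0!, so no carry modulo j occurs and its exponent is 0. For j >= N0 the
    factor pi_j is outside the prime ideal P. *)
Lemma Cnm_residue n : (N0`! < n)%N -> ~ P (Cnm pi n N0`!).
Proof.
move=> hn; rewrite /Cnm /Cab; apply: maximal_prime_prod => // j; rewrite mem_index_iota.
move=> /andP[j2 _] _; have [jN|jN] := leqP N0 j.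
  elim: (eps _ _ _) => [|e IH]; first by rewrite expr0; case: hP.
  by rewrite exprS; apply: maximal_prime => //; exact: hN0.
have d : (j %| N0`!)%N by rewrite dvdn_fact // (ltnW j2) ltnW.
by rewrite /eps divnDr // addKn subnn expr0; case: hP.
Qed.

Variables (m0 : nat) (gen : 'I_m0 -> k).
Hypotheses (genP : forall i, P (gen i))
  (genspan : forall x, P x -> exists c : 'I_m0 -> k, x = \sum_(i < m0) c i * gen i).

Local Notation L := (N0`!).

Definition monomial b : seq k := rcons (nseq b 0) 1.

Lemma nth_monomial b i : (monomial b)`_i = (i == b)%:R.
Proof. by rewrite nth_rcons size_nseq nth_nseq; case: (ltngtP i b). Qed.

(** Generators of P in degree 0, followed by x^[1], ..., x^[N0!]. Together they generate all
    elements whose coefficient in degree 0 lies in P. *)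
Definition relseq (l : 'I_(m0 + L)) : seq k :=
  match fintype.split l with inl i => [:: gen i] | inr b => monomial b.+1 end.

Local Notation rel := (fun l (_ : 'I_1) i => (relseq l)`_i).
Local Notation img u := (rel_image pi rel (fun _ => u)).
Definition del n (c : k) : nat -> k := fun i => if i == n then c else 0.

Lemma img_ext u v : (forall i, u i = v i) -> img u -> img v.
Proof. by move=> /funext ->. Qed.

Lemma img0 : img (fun _ => 0).
Proof.
exists (fun _ _ => 0); first by exists 0%N.
by move=> _ i; rewrite big1 // => l _; rewrite big1 // => a _; rewrite !mul0r.
Qed.

Lemma imgD u v : img u -> img v -> img (fun i => u i + v i).
Proof.
move=> [H [B hB] e] [H' [B' hB'] e']; exists (fun l a => H l a + H' l a).
  exists (maxn B B') => l a; rewrite geq_max => /andP[h h'].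
  by rewrite hB // hB' // addr0.
move=> j i; rewrite (e j) (e' j) -big_split; apply: eq_bigr => l _.
by rewrite -big_split; apply: eq_bigr => a _; rewrite /= !mulrDl.
Qed.

Lemma img_gen l a c :
  img (fun i => if (a <= i)%N then c * (relseq l)`_(i - a) * Cnm pi i (i - a) else 0).
Proof.
exists (fun l' a' => if (l' == l) && (a' == a) then c else 0).
  by exists a.+1 => l' a' h; rewrite (gtn_eqF h) andbF.
move=> _ i; rewrite (bigD1 l) //= [X in _ + X]big1 ?addr0; last first.
  by move=> l' /negPf ne; rewrite big1 // => a' _; rewrite ne !mul0r.
case: leqP => ai.
  have ai' : (a < i.+1)%N by [].
  rewrite (bigD1 (Ordinal ai')) //= !eqxx /= big1 ?addr0 // => a' ne.
  rewrite (_ : (a' == a :> nat) = false) ?mul0r //.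
  by apply: contraNF ne => /eqP e; apply/eqP/val_inj.
rewrite big1 // => a' _; rewrite (_ : (a' == a :> nat) = false) ?andbF ?mul0r //.
by apply/eqP => e; have := ltn_ord a'; rewrite e ltnS leqNgt ai.
Qed.

Lemma Cnm_n0 n : Cnm pi n 0 = 1. Proof. exact: Cab0. Qed.

Lemma Cnm_nn n : Cnm pi n n = 1.
Proof. by rewrite /Cnm subnn /Cab big1 // => j _; rewrite /eps div0n subn0 subnn. Qed.

Lemma img_sum (T : finType) (F : T -> nat -> k) :
  (forall t, img (F t)) -> img (fun i => \sum_t F t i).
Proof.
move=> h; elim: (index_enum T) => [|t s IH].
  by apply: img_ext img0 => i; rewrite big_nil.
by apply: img_ext (imgD (h t) IH) => i; rewrite big_cons.
Qed.

Lemma img_P n x : P x -> img (del n x).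
Proof.
move=> /genspan[c ->].
apply: (@img_ext (fun i => \sum_t del n (c t * gen t) i)).
  by move=> i; rewrite /del; case: eqP => // _; rewrite big1.
apply: img_sum => t; apply: img_ext (img_gen (lshift L t) n (c t)) => i.
rewrite /relseq (unsplitK (inl t)) /del.
case: (ltngtP i n) => [//|h|->]; last by rewrite subnn Cnm_n0 mulr1.
by rewrite -(subnSK h) /= nth_nil mulr0 mul0r.
Qed.

(** Up to degree L this is one of the relations. Beyond, 1 = x + e C(n, L) with x in P, so that c
    x^[n] = c x x^[n] + c e x^[n-L] x^[L]. *)
Lemma img_monomial n c : (0 < n)%N -> img (del n c).
Proof.
move=> n0; have [nL|nL] := leqP n L.
  have bL : (n.-1 < L)%N by rewrite prednK.
  apply: img_ext (img_gen (rshift m0 (Ordinal bL)) 0 c) => i.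
  rewrite leq0n subn0 /relseq (unsplitK (inr (Ordinal bL))) nth_monomial /del /= prednK //.
  by case: eqP => [->|_]; rewrite ?Cnm_nn ?mulr0 ?mul0r ?mulr1.
have [x [e [Px e1]]] := maximal_bezout hP (Cnm_residue nL).
have L0 : (0 < L)%N := fact_gt0 N0.
have bL : (L.-1 < L)%N by rewrite prednK.
have h1 : img (del n (c * x)) by apply: img_P; exact: idealM.
have h2 := img_gen (rshift m0 (Ordinal bL)) (n - L) (c * e).
apply: img_ext (imgD h1 h2) => i.
rewrite /relseq (unsplitK (inr (Ordinal bL))) nth_monomial /del /= prednK //.
case: eqP => [->|ne].
  have -> : (n - (n - L) = L)%N by rewrite subKn // ltnW.
  by rewrite leq_subr eqxx mulr1 -[RHS]mulr1 [X in _ = _ * X]e1 mulrDr mulrA.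
rewrite add0r; case: leqP => // h; rewrite (_ : (_ == _) = false) ?mulr0 ?mul0r //.
by apply/eqP; lia.
Qed.

Lemma img_finsupp (d : seq k) : P d`_0 -> img (fun i => d`_i).
Proof.
move=> h; apply: (@img_ext (fun i => \sum_(n < size d) del n d`_n i)).
  move=> i; have [hi|hi] := ltnP i (size d).
    rewrite (bigD1 (Ordinal hi)) //= /del eqxx big1 ?addr0 // => t ne.
    by rewrite (_ : (_ == _) = false) //; apply: contraNF ne => /eqP e; apply/eqP/val_inj.
  rewrite nth_default // big1 // => t _; rewrite /del (_ : (_ == _) = false) //.
  by apply/eqP => e; have := ltn_ord t; rewrite -e ltnNge hi.
apply: img_sum => -[[|n] hn] /=; [exact: img_P|exact: img_monomial].
Qed.

Lemma residue_module : exists (M : lmodType k) (act : nat -> M -> M) (hom : int -> M -> Prop),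
  [/\ Dmodule pi act, graded act hom, fin_pres pi act & ~ torsion_free act].
Proof.
have [M [q [qZ qeq qsurj]]] := quotient_module PI.
pose act i (x : M) := if i == 0%N then x else 0.
(* The grading concentrated in degree 0. *)
pose hom (d : int) (x : M) := d != 0 -> x = 0.
have q0 x : q x = 0 <-> P x.
  have <- : q 0 = 0 by have := qZ 0 0; rewrite mul0r scale0r.
  by rewrite qeq subr0.
have qE x : q x = x *: q 1 by rewrite -qZ mulr1.
have Dact_q (d : seq k) : Dact act d (q 1) = q d`_0.
  rewrite [RHS]qE; case: d => [|a d]; first by rewrite /Dact big_ord0 scale0r.
  rewrite /Dact big_ord_recl /= big1 ?addr0 // => i _.
  by rewrite /act /= scaler0.
exists M, act, hom; split.
- split=> [i a x y|x|i j x] //.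
    by rewrite /act; case: ifP => // _; rewrite scaler0 addr0.
  rewrite /act; case: i j => [|i] [|j] //=; rewrite ?scaler0 //.
  by rewrite addn0 Cnm_n0 scale1r.
- split; first split=> [d _ //|d x y hx hy h|d a x hx h].
  + by rewrite hx // hy // addr0.
  + by rewrite hx // scaler0.
  split=> [x|s f us hf e d ds|n d x hx].
  + exists [:: 0], (fun e => if e == 0 then x else 0); split=> //.
      by move=> e; rewrite /hom; case: eqP.
    by rewrite big_seq1.
  + have [d0|/hf //] := eqVneq d 0; rewrite -e (bigD1_seq d) //=.
    by rewrite big1 ?addr0 // => e' ne; apply: hf; rewrite -d0.
  + by case: n => [|n]; [rewrite addr0|rewrite /hom].
- exists 1%N, (fun _ => q 1); split=> [x|].
    have [y ->] := qsurj x; exists (fun _ => [:: y]).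
    by rewrite /Dev big_ord1 Dact_q.
  exists (m0 + L)%N, (fun l _ => relseq l); split=> [l|f].
    rewrite /Dev big_ord1 Dact_q; apply/q0; rewrite /relseq.
    by case: (fintype.split l) => [i|b] //=; exact: ideal0.
  rewrite /Dev big_ord1 Dact_q => /q0 /img_finsupp[H [B hB] e].
  exists (fun l => mkseq (H l) B) => j i; rewrite ord1 (e ord0).
  apply: eq_bigr => l _; rewrite nth_Dmul; apply: eq_bigr => a _.
  congr (_ * _ * _); have [h|h] := ltnP a B; first by rewrite nth_mkseq.
  by rewrite nth_default ?size_mkseq // hB.
- move=> /(_ (q 1)) h; have : ~ P 1 by case: hP.
  by apply; apply/q0; apply: h; exists 1%N => -[].
Qed.

End ResidueModule.

Theorem theorem8p1 (k : comPzRingType) (pi : nat -> k) :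
  noetherian k -> admissible pi ->
  (* ungraded finitely presented modules *)
  ((forall (M : lmodType k) (act : nat -> M -> M),
      Dmodule pi act -> fin_pres pi act -> torsion_free act) <-> condB pi) /\
  (* graded finitely presented modules *)
  ((forall (M : lmodType k) (act : nat -> M -> M) (hom : int -> M -> Prop),
      Dmodule pi act -> graded act hom -> fin_pres pi act -> torsion_free act)
     <-> condB pi).
Proof.
move=> noeth adm.
(* The residue module is graded, so the hypothesis on graded modules alone already gives (b), and
   one argument serves both equivalences. *)
have conv : (forall (M : lmodType k) (act : nat -> M -> M) (hom : int -> M -> Prop),
    Dmodule pi act -> graded act hom -> fin_pres pi act -> torsion_free act) ->
    condB pi.
  move=> h P hP N0; apply: contrapT => hno.
  have hN0 n : (N0 <= n)%N -> ~ P (pi n) by move=> hn Pn; apply: hno; exists n.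
  have [PI _ _] := hP; have [m0 [gen [genP genspan]]] := noeth P PI.
  have [M [act [hom [h1 h2 h3]]]] := residue_module hP hN0 genP genspan.
  by apply; apply: h h1 h2 h3.
split; split=> [h|hB M act].
- by apply: conv => M act hom h1 _ h3; exact: h.
- exact: fin_pres_torsion_free.
- exact: conv.
- by move=> hom h1 _ h3; exact: fin_pres_torsion_free h1 h3.
Qed.
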